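(* Let $\psi$ be a Nevanlinna function with canonical representation $$\psi(z)=\alpha z+\beta+\int_{-\infty}^{+\infty}\frac{1+uz}{z-u}\,\nu(du),\qquad z\in\mathbf{C}^+,$$ and let $\Psi$ be a primitive of $-\psi$ on $\mathbf{C}^+$. Then $\Psi(\mathbf{C}^+)$ contains a translate of $\mathbf{C}^+$ if and only if one of the following (mutually exclusive) conditions is fulfilled: (1) $\int_0^\infty u^2\,\nu(du)<+\infty$ and $\alpha<0$; (2) $\int_0^\infty u^2\,\nu(du)<+\infty$, $\alpha=0$ and $\beta+\int_{\mathbf{R}}u\,\nu(du)<0$.
   Context: $\mathbf{C}^+=\{z\in\mathbf{C}:\Im(z)>0\}$, $\mathbf{C}^-=-\mathbf{C}^+$. A Nevanlinna function is an analytic function defined on $\mathbf{C}^+$ with values in $\mathbf{C}^-\cup\mathbf{R}$. Every Nevanlinna function has a unique canonical representation as displayed, with real numbers $\alpha\le 0$ and $\beta$, and $\nu$ a finite positive measure on $\mathbf{R}$. A translate of $\mathbf{C}^+$ is a set $\mathbf{C}^++c$ with $c\in\mathbf{C}$. When $\int_0^\infty u^2\,\nu(du)<+\infty$, one has $\int_0^\infty u\,\nu(du)<+\infty$, so that $\int_{\mathbf{R}}u\,\nu(du)$ is well defined in $[-\infty,+\infty[$; in condition (2) the value $-\infty$ is allowed. *)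

(* Defs.v *)
From HB Require Import structures.
From mathcomp Require Import all_boot all_order all_algebra complex.
From mathcomp Require Import all_classical all_reals all_analysis.

Set Implicit Arguments.
Unset Strict Implicit.
Unset Printing Implicit Defensive.

Import Order.TTheory GRing.Theory Num.Theory.
Import numFieldNormedType.Exports.

Local Open Scope classical_set_scope.
Local Open Scope ring_scope.
Local Open Scope complex_scope.

Definition Cplus (R : realType) : set R[i] := [set z | 0 < complex.Im z].

Definition Cminus (R : realType) : set R[i] := [set - z | z in @Cplus R].

(* [R[i]^o] is [R[i]] as a normed space over the field [R[i]], so the
   directional derivative along [1] is the complex derivative. *)
Definition holomorphic_on (R : realType) (D : set R[i]) (f : R[i] -> R[i]) :
    Prop :=
  forall z : R[i], D z ->
    derivable (f : R[i]^o -> R[i]^o) (z : R[i]^o) (1 : R[i]^o).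

Definition primitive_on (R : realType) (D : set R[i]) (f F : R[i] -> R[i]) :
    Prop :=
  forall z : R[i], D z ->
    is_derive (z : R[i]^o) (1 : R[i]^o) (F : R[i]^o -> R[i]^o) (f z : R[i]^o).

(* Only the values on [Cplus R] are relevant. *)
Definition nevanlinna (R : realType) (psi : R[i] -> R[i]) : Prop :=
  holomorphic_on (@Cplus R) psi /\
  forall z : R[i], Cplus z -> (@Cminus R `|` range (fun x : R => x%:C)) (psi z).

Definition complex_integral (R : realType) (d : measure_display)
    (T : measurableType d) (mu : {measure set T -> \bar R}) (f : T -> R[i]) :
    R[i] :=
  Complex (\int[mu]_x complex.Re (f x)) (\int[mu]_x complex.Im (f x)).

Definition canonical_representation (R : realType) (psi : R[i] -> R[i])
    (alpha beta : R) (nu : {finite_measure set (measurableTypeR R) -> \bar R}) :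
    Prop :=
  alpha <= 0 /\
  forall z : R[i], Cplus z ->
    psi z = alpha%:C * z + beta%:C +
      complex_integral nu (fun u : R => (1 + u%:C * z) / (z - u%:C)).

(* Main.v *)
Require Import Defs.
From HB Require Import structures.
From mathcomp Require Import all_boot all_order all_algebra complex.
From mathcomp Require Import all_classical all_reals all_analysis.
From mathcomp Require Import measurable_realfun ring lra.

Set Implicit Arguments.
Unset Strict Implicit.
Unset Printing Implicit Defensive.

Import Order.TTheory GRing.Theory Num.Theory.
Import numFieldNormedType.Exports.

Local Open Scope classical_set_scope.
Local Open Scope ring_scope.
Local Open Scope complex_scope.

(* Write [Psi = U + iV] and [Psi' = p + iq]; here [q >= 0], so [V] increases
   along horizontal lines and every chord satisfies
   [dU * dy <= dV * dx].

   If the mass [u^2 nu] is finite on the right, [V] is bounded above near the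
   real axis.  If [alpha < 0], chord slopes alone give
   [|Psi z - Psi z0| >= c |z - z0|].  If [alpha = 0] and the mean is negative,
   then [V] is unbounded, and comparing chords from a point where
   [V] is small and from a point where [V] is large confines the points with
   [|Psi| <= B] and [V >= M] to a cone [|x| <= k (1 + y)]; inside such a cone
   [|Psi|] tends to infinity.  Hence [Psi] is proper over a half-plane, and a
   minimiser of [|Psi - w|] is a critical point, which forces [Psi = w] because
   [Psi'] does not vanish.

   Conversely, if [u^2 nu] has infinite mass on the right, some points tend to
   the real axis while [V] is large and [U + iV] converges; as chord slopes are
   quantitatively monotone, the limit is not a value of [Psi].  If this mass is
   finite, [alpha = 0] and the mean is nonnegative, then [V] is bounded above. *)

(** * Real derivatives of a complex primitive *)

Section Calculus.
Variable R : realType.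
Implicit Types (f df g dg : R -> R) (a b c x : R).

(** The second moment on the right matters because [(1 + u^2) y / |z - u|^2], integrated over a
    horizontal line, gives [pi (1 + u^2)] at every height [y]: crossing a mass at [u] raises [V] by
    a multiple of [1 + u^2], however close to the axis. The primitive involved is an arctangent,
    whence the bounded potentials below. These increments need an anchor. Near the axis [psi] may
    grow like [1/y] along a vertical line, for instance above an atom, and then [Psi] is unbounded
    on that line. An abscissa is therefore selected for each height, above which [psi] grows at most
    like [s^(-1/2)], an integrable rate. Inside a cone [|Psi|] tends to infinity for one of two
    reasons. If the left second moment is finite, [q] is negligible and the negative mean makes [V]
    grow. If it is infinite, [p] is hard to control, but [q] is so large that the chord inequality
    alone moves [Psi] far away. *)

Lemma is_derive_continuous f (df x : R) : is_derive x 1 f df -> {for x, continuous f}.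
Proof. by case=> /derivable1_diffP /differentiable_continuous. Qed.

Lemma is_derive_within_continuous f df a b :
  (forall x : R, a <= x <= b -> is_derive x 1 f (df x)) ->
  {within `[a, b], continuous f}.
Proof.
move=> H; apply: continuous_in_subspaceT => x /set_mem /=; rewrite in_itv /= => xab.
exact: is_derive_continuous (H x xab).
Qed.

Lemma derive_ge_increment f df a b c : a <= b ->
  (forall x : R, a <= x <= b -> is_derive x 1 f (df x)) ->
  (forall x, a <= x <= b -> c <= df x) -> c * (b - a) <= f b - f a.
Proof.
move=> ab H1 H2.
have [||x xab ->] := @MVT_segment R f df a b ab.
- by move=> x; rewrite in_itv /= => /andP[/ltW ax /ltW xb]; apply: H1; rewrite ax.
- exact: is_derive_within_continuous H1.
- by apply: ler_wpM2r; [rewrite subr_ge0|apply: H2; rewrite in_itv /= in xab].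
Qed.

Lemma derive_le_increment f df g dg a b : a <= b ->
  (forall x : R, a <= x <= b -> is_derive x 1 f (df x)) ->
  (forall x : R, a <= x <= b -> is_derive x 1 g (dg x)) ->
  (forall x, a <= x <= b -> df x <= dg x) -> f b - f a <= g b - g a.
Proof.
move=> ab H1 H2 H3.
have := @derive_ge_increment (g \- f) (fun x => dg x - df x) a b 0 ab.
rewrite mul0r => /(_ _ _) H.
suff : 0 <= (g \- f) b - (g \- f) a by rewrite /=; lra.
apply: H => x xab.
  by have := H1 x xab; have := H2 x xab => ? ?; exact: is_deriveB.
by rewrite subr_ge0 H3.
Qed.

(** The first half of a segment descending towards the real axis stays in a box away from that axis,
    where [rep_im] has a uniform lower bound; for the second half, monotonicity will suffice. *)
Lemma half_segment_bounds (x0 y0 x y t : R) : 0 <= t <= 2^-1 -> 0 < y -> y <= y0 / 2 ->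
  [/\ y0 / 2 <= y0 + t * (y - y0), y0 + t * (y - y0) <= y0
    & `|x0 + t * (x - x0)| <= 2 * `|x0| + `|x|].
Proof.
move=> /andP[t0 t1] yp yle.
have ty : 0 <= t * y by rewrite mulr_ge0// ltW.
have ty0 : t * y0 <= 2^-1 * y0 by rewrite ler_wpM2r//; lra.
have ty1 : t * y <= t * y0 by rewrite ler_wpM2l//; lra.
split; [lra|lra|].
have h1 : `|t * (x - x0)| <= 1 * (`|x| + `|x0|).
  rewrite normrM (ger0_norm t0); apply: ler_pM => //; last exact: ler_normB.
  by apply: le_trans t1 _; rewrite invf_le1// ler1n.
by have := ler_normD x0 (t * (x - x0)); lra.
Qed.

Lemma normr_increment_le f df g dg a b : a <= b ->
  (forall x : R, a <= x <= b -> is_derive x 1 f (df x)) ->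
  (forall x : R, a <= x <= b -> is_derive x 1 g (dg x)) ->
  (forall x, a <= x <= b -> `|df x| <= dg x) -> `|f b - f a| <= g b - g a.
Proof.
move=> ab df_ dg_ fg; rewrite ler_norml; apply/andP; split; last first.
  apply: (derive_le_increment ab df_ dg_) => x /fg.
  exact: le_trans (ler_norm _).
have := @derive_le_increment (fun x => - f x) (fun x => - df x) g dg a b ab.
have h x : a <= x <= b -> is_derive x 1 (fun x => - f x) (- df x).
  by move=> /df_ ?; exact: is_deriveN.
have h2 x : a <= x <= b -> - df x <= dg x.
  move=> /fg; apply: le_trans; rewrite -normrN; exact: ler_norm.
by move=> /(_ h dg_ h2); lra.
Qed.

Lemma convex_gt0 (y0 y1 t : R) : 0 < y0 -> 0 < y1 -> 0 <= t <= 1 ->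
  0 < y0 + t * (y1 - y0).
Proof.
move=> h0 h1 /andP[t0 t1].
have [->|tn] := eqVneq t 0; first by rewrite mul0r addr0.
have -> : y0 + t * (y1 - y0) = (1 - t) * y0 + t * y1 by ring.
rewrite ltr_wpDl ?mulr_ge0 ?subr_ge0 ?(ltW h0)//.
by rewrite mulr_gt0// lt_neqAle eq_sym tn.
Qed.

End Calculus.

(** * Cauchy-Riemann equations along lines *)

Section ComplexDerivative.
Variable R : realType.

Lemma Re_is_additive (z w : R[i]) : complex.Re (z + w) = complex.Re z + complex.Re w.
Proof. by case: z; case: w. Qed.
Lemma Im_is_additive (z w : R[i]) : complex.Im (z + w) = complex.Im z + complex.Im w.
Proof. by case: z; case: w. Qed.
Lemma Re_opp (z : R[i]) : complex.Re (- z) = - complex.Re z.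
Proof. by case: z. Qed.
Lemma Im_opp (z : R[i]) : complex.Im (- z) = - complex.Im z.
Proof. by case: z. Qed.

Lemma normC_le_ReIm (z : R[i]) :
  `|z| <= (`|complex.Re z| + `|complex.Im z|)%:C.
Proof.
case: z => x y /=; rewrite normc_def /= lecR.
rewrite -[leRHS]ger0_norm ?addr_ge0// -sqrtr_sqr ler_wsqrtr//.
rewrite sqrrD !real_normK ?num_real// lerD2r lerDl.
by rewrite mulrn_wge0 // mulr_ge0.
Qed.

Lemma normC_ge_Im (z : R[i]) : `|complex.Im z|%:C <= `|z|.
Proof.
case: z => x y /=; rewrite normc_def /= lecR -sqrtr_sqr ler_wsqrtr//.
by rewrite lerDr sqr_ge0.
Qed.

Lemma complex_derive_littleo (F : R[i] -> R[i]) (z f' : R[i]) (e : R) : 0 < e ->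
  is_derive (z : R[i]^o) (1 : R[i]^o) (F : R[i]^o -> R[i]^o) (f' : R[i]^o) ->
  exists2 d : R, 0 < d & forall h : R[i], `|h| < d%:C ->
    `|F (z + h) - F z - h * f'| <= e%:C * `|h|.
Proof.
move=> e0 [dF <-].
have eC : (0 : R[i]) < e%:C by rewrite ltcR.
have /cvgrPdist_le /(_ _ eC) := dF.
rewrite /dnbhs /= => -[d /= d0 H].
(* The radius is a priori a complex number; being positive in the order of [R[i]] forces it to be
   real. *)
have [dR d'0] : d = (complex.Re d)%:C /\ 0 < complex.Re d.
  move: d d0 {H} => [a b]; rewrite ltcE /= => /andP[/eqP -> a0]; split => //.
exists (complex.Re d) => //= h; rewrite -dR => hd.
have [->|h0] := eqVneq h 0.
  by rewrite addr0 subrr mul0r subr0 !normr0 mulr0.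
have := H h; rewrite /ball_ /= sub0r normrN => /(_ hd h0).
rewrite {H} /derive /=.
set L := lim _.
rewrite [h *: _](_ : _ = h :> R[i]^o); last by rewrite /GRing.scale /= mulr1.
rewrite [h^-1 *: _](_ : _ = h^-1 * (F (h + z) - F z) :> R[i]); last by [].
move=> H.
have -> : F (z + h) - F z - h * L = - (h * (L - h^-1 * (F (h + z) - F z))).
  by rewrite [h + z]addrC mulrBr mulrA divff// mul1r opprB.
by rewrite normrN normrM mulrC ler_wpM2r.
Qed.

Variables (Psi : R[i] -> R[i]).

(** This is the product of [f'] with the direction [a + ib], split into real and imaginary parts.
    All directions are needed: chords and slanted rays occur besides horizontal and vertical
    lines. *)
Lemma is_derive_ReIm_line (f' : R[i]) (x y a b t : R) :
  is_derive (Complex (x + t * a) (y + t * b) : R[i]^o) (1 : R[i]^o)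
    (Psi : R[i]^o -> R[i]^o) (f' : R[i]^o) ->
  is_derive t 1 (fun s => complex.Re (Psi (Complex (x + s * a) (y + s * b))))
     (complex.Re f' * a - complex.Im f' * b) /\
  is_derive t 1 (fun s => complex.Im (Psi (Complex (x + s * a) (y + s * b))))
     (complex.Im f' * a + complex.Re f' * b).
Proof.
move=> dPsi.
pose G s := Psi (Complex (x + s * a) (y + s * b)).
have key e : 0 < e -> exists2 d : R, 0 < d & forall h, `|h| < d ->
    `|complex.Re (G (h + t)) - complex.Re (G t) - h * (complex.Re f' * a - complex.Im f' * b)|
      <= e * `|h| /\
    `|complex.Im (G (h + t)) - complex.Im (G t) - h * (complex.Im f' * a + complex.Re f' * b)|
      <= e * `|h|.
  move=> e0.
  (* [N] dominates the modulus of the direction; the added 1 keeps it positive when [a = b = 0]. *)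
  pose N := `|a| + `|b| + 1.
  have N0 : 0 < N by rewrite ltr_wpDl// addr_ge0.
  have [d d0 H] := complex_derive_littleo (divr_gt0 e0 N0) dPsi.
  exists (d / N); first exact: divr_gt0.
  move=> h hd.
  pose w := Complex (h * a) (h * b).
  have wN : `|w| <= (`|h| * N)%:C.
    apply: le_trans (normC_le_ReIm _) _; rewrite lecR /= !normrM -mulrDr.
    by rewrite ler_wpM2l// /N lerDl.
  have wd : `|w| < d%:C.
    by apply: le_lt_trans wN _; rewrite ltcR -ltr_pdivlMr.
  have {}H := H _ wd.
  have E : Complex (x + t * a) (y + t * b) + w =
           Complex (x + (h + t) * a) (y + (h + t) * b).
    by rewrite /w; apply/eqP; rewrite eq_complex /=; apply/andP; split; apply/eqP; ring.
  rewrite E in H.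
  have {}H : `|G (h + t) - G t - w * f'| <= (e * `|h|)%:C.
    apply: le_trans H _; apply: le_trans (ler_wpM2l _ wN) _.
      by rewrite lecR divr_ge0// ltW.
    rewrite -rmorphM lecR mulrCA -mulrA mulVf ?mulr1; last by rewrite gt_eqF.
    by rewrite mulrC.
  split.
    have := le_trans (normc_ge_Re _) H; rewrite lecR; congr (`|_| <= _).
    rewrite !Re_is_additive !Re_opp /w; case: (f') => p q /=; ring.
  have := le_trans (normC_ge_Im _) H; rewrite lecR; congr (`|_| <= _).
  rewrite !Im_is_additive !Im_opp /w; case: (f') => p q /=; ring.
have mk (g : R -> R) (l : R) : (forall e, 0 < e -> exists2 d : R, 0 < d &
    forall h, `|h| < d -> `|g (h + t) - g t - h * l| <= e * `|h|) ->
    is_derive t 1 g l.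
  move=> H.
  have cv : h^-1 *: (g (h *: 1 + t) - g t) @[h --> 0^'] --> l.
    apply/cvgrPdist_le => e e0; have [d d0 Hd] := H e e0.
    exists d => //= h; rewrite /ball_ /= sub0r normrN => hd h0.
    rewrite /GRing.scale /= mulr1.
    have -> : l - h^-1 * (g (h + t) - g t) = - (h^-1 * (g (h + t) - g t - h * l)).
      by rewrite [in RHS]mulrBr mulKf// opprB.
    rewrite normrN normrM normfV ler_pdivrMl ?normr_gt0// [leRHS]mulrC.
    exact: Hd.
  apply: DeriveDef.
    by apply/cvg_ex; exists l.
  by apply/cvg_lim => //; exact: cv.
split; apply: mk => e e0; have [d d0 H] := key e e0; exists d => // h /H [].
  by [].
by [].
Qed.

Lemma continuous_ReIm_plane (f' : R[i]) (x y e : R) : 0 < e ->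
  is_derive (Complex x y : R[i]^o) (1 : R[i]^o)
    (Psi : R[i]^o -> R[i]^o) (f' : R[i]^o) ->
  exists2 d : R, 0 < d & forall h k, `|h| < d -> `|k| < d ->
    `|complex.Re (Psi (Complex (x + h) (y + k))) - complex.Re (Psi (Complex x y))| <= e /\
    `|complex.Im (Psi (Complex (x + h) (y + k))) - complex.Im (Psi (Complex x y))| <= e.
Proof.
move=> e0 dPsi.
have [d d0 H] := complex_derive_littleo ltr01 dPsi.
pose L := complex.Re `|f'| + 1.
have nf : `|f'| = (complex.Re `|f'|)%:C by rewrite normc_def.
have L0 : 0 < L.
  rewrite ltr_wpDl//; have : (0 : R[i]) <= `|f'| by [].
  by rewrite nf lecR.
pose d' := Num.min (d / 2) (e / (2 * L)).
have d'0 : 0 < d' by rewrite lt_min !divr_gt0// mulr_gt0.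
exists d' => // h k hd kd.
have wd' : `|Complex h k| < (2 * d')%:C.
  by apply: le_lt_trans (normC_le_ReIm _) _; rewrite ltcR /= mulr_natl mulr2n ltrD.
have wd : `|Complex h k| < d%:C.
  apply: lt_le_trans wd' _; rewrite lecR -ler_pdivlMl// mulrC.
  by rewrite /d' ge_min lexx.
have {}H := H _ wd.
have {H} : `|Psi (Complex (x + h) (y + k)) - Psi (Complex x y)| <= e%:C.
  have -> : Psi (Complex (x + h) (y + k)) - Psi (Complex x y) =
    (Psi (Complex x y + Complex h k) - Psi (Complex x y) - Complex h k * f') +
     Complex h k * f' by rewrite subrK.
  apply: le_trans (ler_normD _ _) _.
  apply: le_trans (lerD H (lexx _)) _.
  rewrite mul1r normrM -[X in X + _]mulr1 -mulrDr mulrC.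
  have -> : 1 + `|f'| = L%:C by rewrite nf addrC /L rmorphD.
  apply: le_trans (ler_wpM2l _ (ltW wd')) _; first by rewrite lecR ltW.
  rewrite -rmorphM lecR mulrA -ler_pdivlMl ?mulr_gt0//.
  rewrite [leRHS](_ : _ = e / (2 * L)); first by rewrite /d' ge_min lexx orbT.
  by rewrite mulrC [L * 2]mulrC.
move=> H; split.
  by have := le_trans (normc_ge_Re _) H; rewrite lecR Re_is_additive Re_opp.
by have := le_trans (normC_ge_Im _) H; rewrite lecR Im_is_additive Im_opp.
Qed.

End ComplexDerivative.

(** * Monotone slopes and surjectivity of proper maps *)

Section HalfPlane.
Variable R : realType.
Variables U V p q : R -> R -> R.

(* [U + iV] has complex derivative [p + iq] on the upper half-plane. *)
Hypothesis dU : forall x y a b t : R, 0 < y + t * b ->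
  is_derive t 1 (fun s => U (x + s * a) (y + s * b))
    (p (x + t * a) (y + t * b) * a - q (x + t * a) (y + t * b) * b).
Hypothesis dV : forall x y a b t : R, 0 < y + t * b ->
  is_derive t 1 (fun s => V (x + s * a) (y + s * b))
    (q (x + t * a) (y + t * b) * a + p (x + t * a) (y + t * b) * b).
Hypothesis q_ge0 : forall x y : R, 0 < y -> 0 <= q x y.

(** [V a - U b] is the imaginary part of [(U + iV)(a - ib)]. Along a chord of direction [(a, b)] its
    derivative is [q (a^2 + b^2)], the terms in [p] cancelling. A lower bound on [q] is asked on
    [[s0, s1]] only, since [q >= 0] elsewhere. *)
Lemma slope_ge (s0 s1 c x0 y0 x1 y1 : R) : 0 <= s0 -> s0 <= s1 -> s1 <= 1 ->
  0 < y0 -> 0 < y1 ->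
  (forall t, s0 <= t <= s1 -> c <= q (x0 + t * (x1 - x0)) (y0 + t * (y1 - y0))) ->
  c * (s1 - s0) * ((x1 - x0) ^+ 2 + (y1 - y0) ^+ 2) <=
  (V x1 y1 - V x0 y0) * (x1 - x0) - (U x1 y1 - U x0 y0) * (y1 - y0).
Proof.
move=> s00 s01 s11 y0p y1p Hq.
set a := x1 - x0; set b := y1 - y0.
pose f t := V (x0 + t * a) (y0 + t * b) * a - U (x0 + t * a) (y0 + t * b) * b.
pose df t := q (x0 + t * a) (y0 + t * b) * (a ^+ 2 + b ^+ 2).
have df_ (t : R) : 0 <= t <= 1 -> is_derive t 1 f (df t).
  move=> t01; have yt := convex_gt0 y0p y1p t01.
  have := dU x0 a yt; have := dV x0 a yt => HV HU.
  have := is_deriveB (is_deriveZ a HV) (is_deriveZ b HU).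
  congr (is_derive _ _ _ _).
    by apply/funext => s; rewrite /f !fctE /GRing.scale /=; congr (_ - _); exact: mulrC.
  by rewrite /df /GRing.scale /= /a /b; ring.
have inc (u v e : R) : 0 <= u -> u <= v -> v <= 1 ->
    (forall t, u <= t <= v -> e <= q (x0 + t * a) (y0 + t * b)) ->
    e * (v - u) * (a ^+ 2 + b ^+ 2) <= f v - f u.
  move=> u0 uv v1 He.
  rewrite [leLHS](_ : _ = e * (a ^+ 2 + b ^+ 2) * (v - u)); last ring.
  have D0 : 0 <= a ^+ 2 + b ^+ 2 by rewrite addr_ge0 ?sqr_ge0.
  apply: (@derive_ge_increment _ f df) => // t /andP[ut tv].
    by apply: df_; rewrite (le_trans u0 ut) (le_trans tv v1).
  by rewrite /df ler_wpM2r// He// ut.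
have q0 t : 0 <= t <= 1 -> 0 <= q (x0 + t * a) (y0 + t * b).
  by move=> t01; apply: q_ge0; exact: convex_gt0.
have i1 := inc 0 s0 0 (lexx _) s00 (le_trans s01 s11).
have i2 := inc s0 s1 c s00 s01 s11 Hq.
have i3 := inc s1 1 0 (le_trans s00 s01) s11 (lexx _).
have f0 : f 0 = V x0 y0 * a - U x0 y0 * b by rewrite /f !mul0r !addr0.
have f1 : f 1 = V x1 y1 * a - U x1 y1 * b.
  by rewrite /f !mul1r /a /b ![_ + (_ - _)]addrC !subrK.
have {}i1 : f 0 <= f s0.
  rewrite -subr_ge0; have := i1; rewrite !mul0r; apply => t /andP[t0 t1].
  by apply: q0; rewrite t0 (le_trans t1)// (le_trans s01).
have {}i3 : f s1 <= f 1.
  rewrite -subr_ge0; have := i3; rewrite !mul0r; apply => t /andP[t0 t1].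
  by apply: q0; rewrite t1 andbT (le_trans s00)// (le_trans s01).
have -> : (V x1 y1 - V x0 y0) * a - (U x1 y1 - U x0 y0) * b = f 1 - f 0.
  by rewrite f0 f1; ring.
lra.
Qed.

Lemma slope (x0 y0 x1 y1 : R) : 0 < y0 -> 0 < y1 ->
  (U x1 y1 - U x0 y0) * (y1 - y0) <= (V x1 y1 - V x0 y0) * (x1 - x0).
Proof.
move=> y0p y1p.
have := @slope_ge 0 1 0 x0 y0 x1 y1 (lexx _) ler01 (lexx _) y0p y1p.
rewrite !mul0r subr_ge0; apply => t t01.
by apply: q_ge0; exact: convex_gt0.
Qed.

(** Dividing [slope_ge] by the length of the chord gives a lower bound on the displacement of
    [U + iV]. The factor 2 comes from [(|a| + |b|)^2 <= 2 (a^2 + b^2)]. *)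
Lemma slope_dist (s0 s1 c x0 y0 x1 y1 : R) : 0 <= s0 -> s0 <= s1 -> s1 <= 1 ->
  0 < y0 -> 0 < y1 -> 0 <= c ->
  (forall t, s0 <= t <= s1 -> c <= q (x0 + t * (x1 - x0)) (y0 + t * (y1 - y0))) ->
  c * (s1 - s0) * (`|x1 - x0| + `|y1 - y0|) <=
  2 * (`|U x1 y1 - U x0 y0| + `|V x1 y1 - V x0 y0|).
Proof.
move=> s00 s01 s11 y0p y1p c0 Hq.
have := slope_ge s00 s01 s11 y0p y1p Hq.
set a := x1 - x0; set b := y1 - y0.
set dv := V x1 y1 - _; set du := U x1 y1 - _ => H.
have cs : 0 <= c * (s1 - s0) by rewrite mulr_ge0// subr_ge0.
set k := c * (s1 - s0) in cs H *.
have [S0|Sn] := eqVneq (`|a| + `|b|) 0.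
  by rewrite S0 mulr0 mulr_ge0// addr_ge0.
have Sp : 0 < `|a| + `|b| by rewrite lt_neqAle eq_sym Sn addr_ge0.
rewrite -(ler_pM2r Sp).
have h1 : dv * a <= `|dv| * `|a| by rewrite -normrM ler_norm.
have h2 : - (du * b) <= `|du| * `|b| by rewrite -normrM -normrN ler_norm.
have e1 : a ^+ 2 = `|a| ^+ 2 by rewrite real_normK ?num_real.
have e2 : b ^+ 2 = `|b| ^+ 2 by rewrite real_normK ?num_real.
have h3 : k * (`|a| + `|b|) * (`|a| + `|b|) <= 2 * (k * (a ^+ 2 + b ^+ 2)).
  have -> : k * (`|a| + `|b|) * (`|a| + `|b|) = k * (`|a| + `|b|) ^+ 2 by ring.
  rewrite [leRHS]mulrCA ler_wpM2l// e1 e2; have := sqr_ge0 (`|a| - `|b|); lra.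
have h4 : 0 <= `|dv| * `|b| by rewrite mulr_ge0.
have h5 : 0 <= `|du| * `|a| by rewrite mulr_ge0.
lra.
Qed.

Lemma V_nondecreasing (x0 x1 y : R) : 0 < y -> x0 <= x1 -> V x0 y <= V x1 y.
Proof.
move=> y0 x01.
have [->//|xn] := eqVneq x0 x1.
have := slope x0 x1 y0 y0; rewrite subrr mulr0 pmulr_lge0 ?subr_ge0//.
by rewrite subr_gt0 lt_neqAle xn.
Qed.

Lemma is_derive_horizontal (x y : R) : 0 < y ->
  is_derive x 1 (fun s => U s y) (p x y) /\ is_derive x 1 (fun s => V s y) (q x y).
Proof.
move=> y0.
have yt : 0 < y + x * 0 by rewrite mulr0 addr0.
have := dU 0 1 yt; have := dV 0 1 yt.
rewrite !mulr0 !mulr1 !addr0 !add0r subr0 => HV HU.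
split; [move: HU|move: HV]; congr (is_derive _ _ _ _);
  by apply/funext => s; rewrite mulr0 mulr1 addr0 add0r.
Qed.

Lemma is_derive_vertical (x y : R) : 0 < y ->
  is_derive y 1 (U x) (- q x y) /\ is_derive y 1 (V x) (p x y).
Proof.
move=> y0.
have yt : 0 < 0 + y * 1 by rewrite mulr1 add0r.
have := dU x 0 yt; have := dV x 0 yt.
rewrite !mulr0 !mulr1 !addr0 !add0r => HV HU.
split; [move: HU|move: HV]; congr (is_derive _ _ _ _);
  by apply/funext => s; rewrite mulr0 mulr1 addr0 add0r.
Qed.

Lemma global_min_attains (x y a b : R) : 0 < y -> p x y ^+ 2 + q x y ^+ 2 != 0 ->
  (forall x' y', 0 < y' -> (U x y - a) ^+ 2 + (V x y - b) ^+ 2 <=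
     (U x' y' - a) ^+ 2 + (V x' y' - b) ^+ 2) ->
  U x y = a /\ V x y = b.
Proof.
move=> y0 pq0 Hmin.
(* The radius [y] of the interval is the largest for which a vertical segment centred at height [y]
   stays in the upper half-plane. *)
have crit (g h dg dh : R -> R) (c : R) :
    (forall t : R, t \in `]c - y, c + y[ -> is_derive t 1 g (dg t)) ->
    (forall t : R, t \in `]c - y, c + y[ -> is_derive t 1 h (dh t)) ->
    (forall t : R, t \in `]c - y, c + y[ ->
      (g c - a) ^+ 2 + (h c - b) ^+ 2 <= (g t - a) ^+ 2 + (h t - b) ^+ 2) ->
    (g c - a) * dg c + (h c - b) * dh c = 0.
  move=> Hg Hh Hm.
  pose F t := (g t - a) ^+ 2 + (h t - b) ^+ 2.
  have dF (t : R) : t \in `]c - y, c + y[ ->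
      is_derive t 1 F (2 * ((g t - a) * dg t + (h t - b) * dh t)).
    move=> tI; have := Hg _ tI; have := Hh _ tI => dh1 dg1.
    have -> : F = (g - cst a) ^+ 2 + (h - cst b) ^+ 2.
      by apply/funext => s; rewrite /F !fctE.
    have := is_deriveD (is_deriveX 2 (is_deriveB dg1 (is_derive_cst a t 1)))
      (is_deriveX 2 (is_deriveB dh1 (is_derive_cst b t 1))).
    by congr (is_derive _ _ _ _); rewrite /GRing.scale /= !fctE; ring.
  have cI : c \in `]c - y, c + y[ by rewrite in_itv /= ltrBlDr ltrDl y0.
  have := @derive1_at_min R F (c - y) (c + y) c.
  have -> : c - y <= c + y by lra.
  move=> /(_ isT) H.
  have [] := H _ cI Hm; first by move=> t /dF[].
  by have [_ ->] := dF _ cI => _ /eqP; rewrite mulf_eq0 pnatr_eq0 /= => /eqP.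
have e1 : (U x y - a) * p x y + (V x y - b) * q x y = 0.
  apply: (crit (U ^~ y) (V ^~ y) (p ^~ y) (q ^~ y)).
  - by move=> t _; have [] := is_derive_horizontal t y0.
  - by move=> t _; have [] := is_derive_horizontal t y0.
  - by move=> t _; exact: Hmin.
have e2 : (U x y - a) * - q x y + (V x y - b) * p x y = 0.
  have tp t : t \in `]y - y, y + y[ -> 0 < t.
    by rewrite in_itv /= subrr => /andP[].
  apply: (crit (U x) (V x) (fun s => - q x s) (p x)).
  - by move=> t /tp t0; have [] := is_derive_vertical x t0.
  - by move=> t /tp t0; have [] := is_derive_vertical x t0.
  - by move=> t /tp t0; exact: Hmin.
(* [e1] and [e2] say that the conjugate of [Psi - w] times [Psi'] is zero; eliminating between them
   multiplies each component of [Psi - w] by [|Psi'|^2]. *)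
have f1 : (U x y - a) * (p x y ^+ 2 + q x y ^+ 2) = 0.
  rewrite (_ : _ * _ = p x y * 0 - q x y * 0); first by rewrite !mulr0 subr0.
  by rewrite -{1}e1 -{1}e2; ring.
have f2 : (V x y - b) * (p x y ^+ 2 + q x y ^+ 2) = 0.
  rewrite (_ : _ * _ = q x y * 0 + p x y * 0); first by rewrite !mulr0 addr0.
  by rewrite -{1}e1 -{1}e2; ring.
move/eqP: f1; move/eqP: f2.
by rewrite !mulf_eq0 (negPf pq0) !orbF !subr_eq0 => /eqP -> /eqP ->.
Qed.

Hypothesis cUV : forall x y e : R, 0 < y -> 0 < e -> exists2 d : R, 0 < d &
  forall h k, `|h| < d -> `|k| < d ->
  `|U (x + h) (y + k) - U x y| <= e /\ `|V (x + h) (y + k) - V x y| <= e.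
Hypothesis pq_neq0 : forall x y : R, 0 < y -> p x y ^+ 2 + q x y ^+ 2 != 0.

Lemma continuous_plane (x y : R) : 0 < y ->
  {for (x, y), continuous (fun z : R * R => U z.1 z.2)} /\
  {for (x, y), continuous (fun z : R * R => V z.1 z.2)}.
Proof.
move=> y0.
have near_ (e : R) : 0 < e -> \forall z \near (x, y),
   `|U z.1 z.2 - U x y| <= e /\ `|V z.1 z.2 - V x y| <= e.
  move=> e0; have [d d0 H] := cUV x y0 e0.
  exists (ball x d, ball y d) => /=.
    by split; exact: nbhsx_ballx.
  move=> [x' y'] /= [hx hy].
  have := H (x' - x) (y' - y); rewrite ![_ + (_ - _)]addrC !subrK; apply.
    by rewrite distrC.
  by rewrite distrC.
by split; apply/cvgrPdist_le => e /near_; apply: filterS => z [h1 h2];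
  rewrite distrC.
Qed.

(** Properness only concerns points with [V >= M]. The condition [M <= b - r] places the whole disc
    of radius [r] about the target there, so that its preimage lies in a compact box and a minimum
    over the box is global. *)
Lemma attained_near (M x1 y1 a b r : R) :
  (forall B : R, exists L e : R, 0 < e /\ forall x y : R, 0 < y -> M <= V x y ->
     `|U x y| <= B -> `|V x y| <= B -> `|x| <= L /\ e <= y <= L) ->
  0 < y1 -> 0 <= r -> (U x1 y1 - a) ^+ 2 + (V x1 y1 - b) ^+ 2 <= r ^+ 2 ->
  M <= b - r -> exists x y, [/\ 0 < y, U x y = a & V x y = b].
Proof.
move=> proper y1p r0 H1 Mbr.
have near_w x y : (U x y - a) ^+ 2 + (V x y - b) ^+ 2 <= r ^+ 2 ->
    `|U x y - a| <= r /\ `|V x y - b| <= r.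
  move=> H; split; rewrite -(@ler_pXn2r _ 2) ?nnegrE//= real_normK ?num_real//.
    by apply: le_trans H; rewrite lerDl sqr_ge0.
  by apply: le_trans H; rewrite lerDr sqr_ge0.
have [L [e [e0 HL]]] := proper (`|a| + `|b| + r).
have inbox x y : 0 < y -> (U x y - a) ^+ 2 + (V x y - b) ^+ 2 <= r ^+ 2 ->
    `|x| <= L /\ e <= y <= L.
  move=> yp /near_w [h1 h2]; apply: HL => //.
  - by move: h2; rewrite ler_norml; lra.
  - have := ler_normD (U x y - a) a; rewrite subrK.
    have := normr_ge0 b; lra.
  - have := ler_normD (V x y - b) b; rewrite subrK.
    have := normr_ge0 a; lra.
pose A : set (R * R) := `[- L, L] `*` `[e, L].
pose f (z : R * R) := (U z.1 z.2 - a) ^+ 2 + (V z.1 z.2 - b) ^+ 2.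
have inA x y : `|x| <= L /\ e <= y <= L -> A (x, y).
  by move=> [h1 h2]; split; rewrite /= in_itv /= ?h2// -ler_norml.
have A0 : A !=set0 by exists (x1, y1); apply: inA; exact: inbox.
have cA : compact A by apply: compact_setX; exact: segment_compact.
have cf : {within A, continuous f}.
  apply: continuous_in_subspaceT => -[x y] /set_mem [_ /=]; rewrite in_itv /= => /andP[ey _].
  have [cU cV] := continuous_plane x (lt_le_trans e0 ey).
  apply: cvgD.
    by apply: cvgM; apply: cvgB => //; exact: cvg_cst.
  by apply: cvgM; apply: cvgB => //; exact: cvg_cst.
have [[x y] /set_mem Axy Hmin] := compact_EVT_min A0 cA cf.
have yp : 0 < y.
  by case: Axy => _ /=; rewrite in_itv /= => /andP[ey _]; exact: lt_le_trans ey.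
have m1 : f (x, y) <= r ^+ 2.
  by apply: (le_trans (Hmin (x1, y1) _) H1); apply/mem_set; apply: inA; exact: inbox.
exists x, y.
have [|-> ->//] := @global_min_attains x y a b yp (pq_neq0 x yp).
move=> x' y' y'p.
have [h|/ltW h] := leP ((U x' y' - a) ^+ 2 + (V x' y' - b) ^+ 2) (r ^+ 2).
  by apply: (Hmin (x', y')); apply/mem_set; apply: inA; exact: inbox.
exact: le_trans m1 h.
Qed.

(** Continuation along the segment from a known value to the target, cut into steps of length at
    most [r]: the preimage of one subdivision point starts the minimisation for the next. *)
Lemma proper_surjective (M x1 y1 : R) :
  (forall B : R, exists L e : R, 0 < e /\ forall x y : R, 0 < y -> M <= V x y ->
     `|U x y| <= B -> `|V x y| <= B -> `|x| <= L /\ e <= y <= L) ->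
  0 < y1 -> M < V x1 y1 ->
  forall a b, M < b -> exists x y, [/\ 0 < y, U x y = a & V x y = b].
Proof.
move=> proper y1p M1 a b Mb.
pose a0 := U x1 y1; pose b0 := V x1 y1.
(* Every point of the segment has imaginary part at least [m], so the disc of radius [r] about it
   stays above [M]. *)
pose m := Num.min b0 b; pose r := m - M.
have r0 : 0 < r by rewrite subr_gt0 lt_min M1.
pose S := `|a - a0| + `|b - b0|.
have S0 : 0 <= S by rewrite addr_ge0.
pose N := (Num.truncn (S / r)).+1.
have N0 : 0 < N%:R :> R by rewrite ltr0n.
have SN : S / N%:R <= r.
  by rewrite ler_pdivrMr// -ler_pdivrMl// mulrC ltW// truncnS_gt.
have step j : (j <= N)%N -> exists x y, [/\ 0 < y,
    U x y = a0 + j%:R / N%:R * (a - a0) & V x y = b0 + j%:R / N%:R * (b - b0)].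
  elim: j => [_|j IH jN].
    by exists x1, y1; split => //; rewrite !mul0r addr0.
  have [x [y [yp hU hV]]] := IH (ltnW jN).
  apply: (attained_near (x1 := x) (y1 := y) (r := r) proper) => //.
  - exact: ltW.
  - rewrite hU hV.
    apply: (@le_trans _ _ ((S / N%:R) ^+ 2)); last first.
      by rewrite ler_pXn2r ?nnegrE ?divr_ge0// ltW.
    rewrite -[j.+1]addn1 natrD.
    rewrite [leLHS](_ : _ = (`|a - a0| ^+ 2 + `|b - b0| ^+ 2) / N%:R ^+ 2).
      rewrite expr_div_n ler_wpM2r ?invr_ge0 ?exprn_ge0// /S.
      have : 0 <= `|a - a0| * `|b - b0| by rewrite mulr_ge0.
      by lra.
    by rewrite !real_normK ?num_real//; field; rewrite gt_eqF.
  - rewrite /r.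
    have t0 : 0 <= j.+1%:R / N%:R :> R by apply: divr_ge0.
    have t1 : j.+1%:R / N%:R <= 1 :> R by rewrite ler_pdivrMr// mul1r ler_nat.
    move: t0 t1; set t := _ / _ => t0 t1.
    have m1 : m <= b0 by rewrite ge_min lexx.
    have m2 : m <= b by rewrite ge_min lexx orbT.
    have : 0 <= (1 - t) * (b0 - m) by rewrite mulr_ge0// subr_ge0.
    have : 0 <= t * (b - m) by rewrite mulr_ge0// subr_ge0.
    lra.
have [x [y]] := step N (leqnn _).
rewrite divff ?gt_eqF// !mul1r ![_ + (_ - _)]addrC !subrK => H.
by exists x, y.
Qed.

End HalfPlane.

(** * The kernel of the Nevanlinna representation *)

Section Kernels.
Variable R : realType.
Implicit Types x y u s t J : R.

(* Minus the imaginary part, and the real part, of [(1 + uz) / (z - u)] at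
   [z = x + iy]. *)
Definition im_kernel x y u := (1 + u ^+ 2) * (y / ((x - u) ^+ 2 + y ^+ 2)).
Definition re_kernel x y u := u + (1 + u ^+ 2) * ((x - u) / ((x - u) ^+ 2 + y ^+ 2)).

Lemma sqrD_gt0 t y : 0 < y -> 0 < t ^+ 2 + y ^+ 2.
Proof. by move=> y0; rewrite ltr_wpDl ?sqr_ge0// exprn_gt0. Qed.

Lemma im_kernel_ge0 x y u : 0 < y -> 0 <= im_kernel x y u.
Proof.
move=> y0; rewrite mulr_ge0 ?addr_ge0 ?sqr_ge0// divr_ge0 ?(ltW y0)//.
by rewrite ltW// sqrD_gt0.
Qed.

(** The denominator [(x - u)^2 + y^2] is at most [2 (1 + u^2) (1 + x^2 + y^2)]; the weight [1 + u^2]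
    makes the bound uniform in [u]. *)
Lemma im_kernel_ge x y u : 0 < y -> y / (2 * (1 + x ^+ 2 + y ^+ 2)) <= im_kernel x y u.
Proof.
move=> y0; have d0 := sqrD_gt0 (x - u) y0.
have e0 : 0 < 2 * (1 + x ^+ 2 + y ^+ 2).
  by have := sqr_ge0 x; have := sqr_ge0 y; lra.
rewrite /im_kernel mulrCA ler_wpM2l ?(ltW y0)// -[leLHS]mul1r ler_pdivrMr// mulrAC.
rewrite ler_pdivlMr// mul1r.
have := sqr_ge0 (x + u); have := sqr_ge0 (x * u); have := sqr_ge0 (y * u).
have := sqr_ge0 y; have := sqr_ge0 x; have := sqr_ge0 u; nra.
Qed.

(** [J] is any majorant of [1 / |z - u|]. It stays abstract because it will be [y^-1], a constant,
    or built from the tame kernel. *)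
Lemma kernel_le x y u J : 0 < y -> 0 <= J -> 1 <= J ^+ 2 * ((x - u) ^+ 2 + y ^+ 2) ->
  im_kernel x y u <= 2 * y + (1 + 2 * x ^+ 2) * J /\
  `|re_kernel x y u| <= 3 * `|x| + y + (1 + x ^+ 2) * J.
Proof.
move=> y0 J0; rewrite /im_kernel /re_kernel.
pose t := x - u; have -> : u = x - t by rewrite /t opprB addrC subrK.
rewrite [x - (x - t)](_ : _ = t); last by ring.
set D := t ^+ 2 + y ^+ 2 => HJ.
have d0 : 0 < D := sqrD_gt0 t y0.
have le_sq w : w ^+ 2 <= D -> `|w| / D <= J.
  move=> wD; rewrite ler_pdivrMr//.
  rewrite -(@ler_pXn2r _ 2) ?nnegrE// ?mulr_ge0 ?(ltW d0)//.
  rewrite real_normK ?num_real// (le_trans wD)// exprMn [D ^+ 2]expr2 mulrA.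
  by rewrite ler_peMl// ltW.
have yJ : y / D <= J by rewrite -{1}(gtr0_norm y0) le_sq// lerDr sqr_ge0.
have tJ : `|t| / D <= J by rewrite le_sq// lerDl sqr_ge0.
have yy : y ^+ 2 / D <= 1 by rewrite ler_pdivrMr// mul1r lerDr sqr_ge0.
have tt : t ^+ 2 / D <= 1 by rewrite ler_pdivrMr// mul1r lerDl sqr_ge0.
have tt0 : 0 <= t ^+ 2 / D by rewrite divr_ge0 ?sqr_ge0 ?ltW.
have yD0 : 0 <= y / D by rewrite divr_ge0 ?ltW.
split.
  have -> : (1 + (x - t) ^+ 2) * (y / D) =
    (1 + 2 * x ^+ 2) * (y / D) + 2 * y * (t ^+ 2 / D) - (x + t) ^+ 2 * (y / D).
    by ring.
  have h1 : (1 + 2 * x ^+ 2) * (y / D) <= (1 + 2 * x ^+ 2) * J.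
    by rewrite ler_wpM2l//; have := sqr_ge0 x; lra.
  have h2 : 2 * y * (t ^+ 2 / D) <= 2 * y * 1 by rewrite ler_wpM2l//; lra.
  have h3 : 0 <= (x + t) ^+ 2 * (y / D) by rewrite mulr_ge0// sqr_ge0.
  lra.
(* This form shows the cancellation between [u] and the linear growth of the second summand:
   [t^2 / D] and [t y / D] are bounded, and [t / D] is controlled by [J]. *)
have -> : x - t + (1 + (x - t) ^+ 2) * (t / D) =
  x * (1 - 2 * (t ^+ 2 / D)) + (1 + x ^+ 2) * (t / D) - y * (t * y / D).
  by rewrite /D; field; rewrite gt_eqF.
have h1 : `|x * (1 - 2 * (t ^+ 2 / D))| <= `|x| * 3.
  by rewrite normrM ler_wpM2l// ler_norml; lra.
have h2 : `|(1 + x ^+ 2) * (t / D)| <= (1 + x ^+ 2) * J.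
  have x0 : 0 <= 1 + x ^+ 2 by have := sqr_ge0 x; lra.
  by rewrite normrM (ger0_norm x0) ler_wpM2l// normrM normfV (gtr0_norm d0).
have h3 : `|y * (t * y / D)| <= y * 1.
  rewrite normrM (gtr0_norm y0) ler_wpM2l ?(ltW y0)// normrM normfV (gtr0_norm d0).
  rewrite ler_pdivrMr// mul1r /D ler_norml; have := sqr_ge0 (t + y).
  have := sqr_ge0 (t - y); have := sqr_ge0 t; have := sqr_ge0 y; lra.
have := ler_normB (x * (1 - 2 * (t ^+ 2 / D)) + (1 + x ^+ 2) * (t / D)) (y * (t * y / D)).
have := ler_normD (x * (1 - 2 * (t ^+ 2 / D))) ((1 + x ^+ 2) * (t / D)).
lra.
Qed.

Lemma kernel_bounded x y u : 0 < y ->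
  im_kernel x y u <= 2 * y + (1 + 2 * x ^+ 2) * y^-1 /\
  `|re_kernel x y u| <= 3 * `|x| + y + (1 + x ^+ 2) * y^-1.
Proof.
move=> y0; apply: kernel_le => //; first by rewrite invr_ge0 ltW.
have -> : y^-1 ^+ 2 * ((x - u) ^+ 2 + y ^+ 2) = ((x - u) / y) ^+ 2 + 1.
  by field; rewrite gt_eqF.
by rewrite lerDr sqr_ge0.
Qed.

Lemma continuous_inv_sqrD x y : 0 < y ->
  continuous (fun u : R => ((x - u) ^+ 2 + y ^+ 2)^-1).
Proof.
move=> y0 u; apply: cvgV; first by rewrite gt_eqF// sqrD_gt0.
by apply: cvgD; [apply: cvgM; (apply: cvgB; [exact: cvg_cst|exact: cvg_id])|exact: cvg_cst].
Qed.

Lemma continuous_one_sqr : continuous (fun u : R => 1 + u ^+ 2).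
Proof. by move=> u; apply: cvgD; [exact: cvg_cst|apply: cvgM; exact: cvg_id]. Qed.

Lemma continuous_im_kernel x y : 0 < y -> continuous (im_kernel x y).
Proof.
move=> y0 u; apply: cvgM; first exact: continuous_one_sqr.
by apply: cvgM; [exact: cvg_cst|exact: continuous_inv_sqrD].
Qed.

Lemma continuous_re_kernel x y : 0 < y -> continuous (re_kernel x y).
Proof.
move=> y0 u; apply: cvgD; first exact: cvg_id.
apply: cvgM; first exact: continuous_one_sqr.
apply: cvgM; last exact: continuous_inv_sqrD.
by apply: cvgB; [exact: cvg_cst|exact: cvg_id].
Qed.

Lemma is_derive_atan_x x y u : 0 < y ->
  is_derive x 1 (fun s => atan ((s - u) / y)) (y / ((x - u) ^+ 2 + y ^+ 2)).
Proof.
move=> y0.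
have d1 : is_derive x 1 (fun s : R => (s - u) / y) (y^-1).
  have -> : (fun s : R => (s - u) / y) = (y^-1 *: (id - cst u)).
    by apply/funext => s; rewrite !fctE /GRing.scale /= mulrC.
  by apply: is_derive_eq; rewrite subr0 /GRing.scale /= mulr1.
have := @is_derive1_comp R atan (fun s => (s - u) / y) x _ _ (is_derive1_atan _) d1.
congr (is_derive _ _ _ _); field.
by rewrite !gt_eqF ?sqrD_gt0.
Qed.

Lemma is_derive_atan_y t y : 0 < y ->
  is_derive y 1 (fun s => atan (t / s)) (- (t / (t ^+ 2 + y ^+ 2))).
Proof.
move=> y0.
have yn : y != 0 by rewrite gt_eqF.
have d1 : is_derive y 1 (fun s : R => t / s) (- (t / y ^+ 2)).
  have := is_deriveZ t (@is_deriveV R id y _ _ yn (is_derive_id y 1)).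
  congr (is_derive _ _ _ _).
  by rewrite /GRing.scale /=; field.
have := @is_derive1_comp R atan (fun s => t / s) y _ _ (is_derive1_atan _) d1.
congr (is_derive _ _ _ _); field.
by rewrite !gt_eqF ?sqrD_gt0.
Qed.

Lemma one_sqr_ge0 u : 0 <= 1 + u ^+ 2.
Proof. by have := sqr_ge0 u; lra. Qed.

Lemma normr_atan_le2 (t : R) : `|atan t| <= 2.
Proof.
rewrite ler_norml; have := atan_ltpi2 t; have := atan_gtNpi2 t.
by have := pihalf_lt2 R; lra.
Qed.

End Kernels.

(** * Integration against a finite measure *)

Section Integrals.
Variable R : realType.
Variable nu : {finite_measure set (measurableTypeR R) -> \bar R}.
Implicit Types (D : set (measurableTypeR R)) (f g : R -> R).

Local Notation integrable D f := (nu.-integrable D (EFin \o f)).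

Lemma continuous_measurable_EFin D f :
  continuous f -> measurable_fun D (EFin \o f).
Proof.
by move=> cf; apply/measurable_EFinP; apply: measurable_funTS; exact: continuous_measurable_fun.
Qed.

Lemma continuous_integrable D f g : measurable D -> continuous f -> integrable D g ->
  (forall u, D u -> `|f u| <= g u) -> integrable D f.
Proof.
move=> mD cf ig fg.
apply: (le_integrable mD (g := EFin \o g)) => //.
  exact: continuous_measurable_EFin.
by move=> u Du; rewrite /= lee_fin (le_trans (fg _ Du))// ler_norm.
Qed.

Lemma integrable_cst D (k : R) : measurable D -> integrable D (fun=> k).
Proof. by move=> mD; exact: (finite_measure_integrable_cst nu k mD). Qed.

Lemma bounded_continuous_integrable D f (k : R) : measurable D -> continuous f ->
  (forall u, D u -> `|f u| <= k) -> integrable D f.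
Proof.
by move=> mD cf fk; apply: (continuous_integrable mD cf (g := fun=> k)) => //;
  exact: integrable_cst.
Qed.

Lemma integrable_scale D (k : R) f : measurable D -> integrable D f ->
  integrable D (fun u => k * f u).
Proof.
move=> mD fi.
have : nu.-integrable D (fun u => k%:E * (EFin \o f) u)%E by exact: integrableZl.
by apply: eq_integrable => // u _; rewrite /= EFinM.
Qed.

Lemma integrable_sum D f g : measurable D -> integrable D f -> integrable D g ->
  integrable D (fun u => f u + g u).
Proof.
move=> mD fi gi; have := integrableD mD fi gi.
by apply: eq_integrable => // u _; rewrite /= EFinD.
Qed.

Lemma is_derive_integral D (f df : R -> R -> R) g (a u v : R) : measurable D ->
  u < a < v ->
  (forall x, u < x < v -> integrable D (f x)) ->
  (forall x y : R, u < x < v -> D y -> is_derive x 1 (f ^~ y) (df x y)) ->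
  (forall y, 0 <= g y) -> integrable D g ->
  (forall x y, u < x < v -> D y -> `|df x y| <= g y) ->
  is_derive a 1 (fun x => \int[nu]_(y in D) f x y) (\int[nu]_(y in D) df a y).
Proof.
move=> mD uav intf derf g0 intg dfg.
have I x : (`]u, v[%classic : set R) x -> u < x < v by rewrite /= in_itv.
have Ia : (`]u, v[%classic : set R) a by rewrite /= in_itv.
have d1 x y : (`]u, v[%classic : set R) x -> D y -> partial1of2 f x y = df x y.
  by move=> /I xI Dy; rewrite partial1of2E; have [_ ->] := derf _ _ xI Dy.
have H1 x : (`]u, v[%classic : set R) x -> nu.-integrable D (EFin \o f x).
  by move=> /I; exact: intf.
have H2 x y : (`]u, v[%classic : set R) x -> D y -> derivable (f ^~ y) x 1.
  by move=> /I xI Dy; have [] := derf _ _ xI Dy.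
have H3 x y : (`]u, v[%classic : set R) x -> D y -> `|partial1of2 f x y| <= g y.
  by move=> xI Dy; rewrite d1//; apply: dfg => //; exact: I.
apply: DeriveDef.
  exact: (derivable_under_integral mD Ia H1 H2 g0 intg H3).
rewrite -derive1E (differentiation_under_integral mD Ia H1 H2 g0 intg H3).
by apply: eq_Rintegral => y /set_mem Dy; exact: d1.
Qed.

Lemma le_Rintegral_set D f : measurable D -> integrable setT f ->
  (forall u, 0 <= f u) -> \int[nu]_(u in D) f u <= \int[nu]_u f u.
Proof.
move=> mD fi f0.
have iD : integrable D f by apply: integrableS fi.
have iC : integrable (~` D) f by apply: integrableS fi => //; exact: measurableC.
rewrite -(setUv D) Rintegral_setU//; last 3 first.
- exact: measurableC.
- by rewrite setUv.
- by apply/disj_set2P; rewrite setICr.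
by rewrite lerDl; apply: Rintegral_ge0.
Qed.

Lemma normr_Rintegral_le D f g : measurable D -> integrable D f -> integrable D g ->
  (forall u, D u -> `|f u| <= g u) -> `|\int[nu]_(u in D) f u| <= \int[nu]_(u in D) g u.
Proof.
move=> mD fi gi fg.
apply: le_trans (le_normr_Rintegral mD fi) _.
apply: le_Rintegral => //.
have := integrable_abse fi; congr (nu.-integrable _ _).
Qed.

(** Monotone convergence over [[- n, n]]. The integral over [D] may be infinite, while continuity
    makes the truncated one finite, hence a real number. *)
Lemma truncate_integral D f (c : R) : measurable D -> continuous f ->
  (forall u, D u -> 0 <= f u) -> (c%:E < \int[nu]_(u in D) (f u)%:E)%E ->
  exists2 N : R, 0 < N & c < \int[nu]_(u in D `&` `[- N, N]) f u.
Proof.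
move=> mD cf f0 H.
pose F n := D `&` `[- n%:R, n%:R].
have mF n : measurable (F n) by apply: measurableI.
have FS : {homo F : n m / (n <= m)%N >-> (n <= m)%O}.
  move=> n k nk; apply/subsetPset => u [Du]; rewrite /= !in_itv /= => /andP[h1 h2].
  have nk' : n%:R <= k%:R :> R by rewrite ler_nat.
  by split => //; rewrite /= in_itv /=; apply/andP; split; lra.
have UF : \bigcup_n F n = D.
  apply/seteqP; split => [u [n _ []//]|u Du].
  exists (Num.truncn `|u|).+1 => //; split => //=.
  by rewrite in_itv /= -ler_norml ltW// truncnS_gt.
have mf n : measurable_fun (F n) (EFin \o f).
  exact: continuous_measurable_EFin.
have F0 n u : F n u -> (0 <= (EFin \o f) u)%E.
  by move=> [Du _]; rewrite lee_fin f0.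
have cv := ge0_nondecreasing_set_cvg_integral (mu := nu) FS mF mf F0.
rewrite UF in cv.
have [n Hn] : exists n : nat, (c%:E < \int[nu]_(u in F n) (f u)%:E)%E.
  apply: contrapT => /forallNP Hn.
  move: H; apply/negP; rewrite -leNgt.
  apply: (cvge_to_le cv).
  by apply: nearW => n /=; rewrite leNgt; apply/negP; exact: Hn.
(* [n] may be 0; its successor gives a positive cutoff. *)
exists n.+1%:R; first by rewrite ltr0n.
have finF k : (\int[nu]_(u in F k) (f u)%:E < +oo)%E.
  have : integrable (F k) f.
    have := @EVT_max R (fun u => `|f u|) (- k%:R) k%:R _ _.
    case.
    - by have := ler0n R k; lra.
    - by apply: continuous_in_subspaceT => u _; apply: cvg_norm; exact: cf.
    move=> c0 _ Hc; apply: (bounded_continuous_integrable (k := `|f c0|)) => //.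
    by move=> u [_ /= ku]; exact: Hc.
  move=> /integrableP[_]; apply: le_lt_trans.
  apply: ge0_le_integral => //=.
  - by move=> u /F0.
  - apply/measurable_EFinP; apply: measurable_funTS; apply: continuous_measurable_fun.
    by move=> u; apply: cvg_norm; exact: cf.
  - by move=> u _; rewrite lee_fin ler_norm.
have fe : (\int[nu]_(u in F n.+1) (f u)%:E)%E = (\int[nu]_(u in F n.+1) f u)%:E.
  rewrite /Rintegral fineK// fin_numElt finF andbT.
  apply: (@lt_le_trans _ _ 0%E) => //; apply: integral_ge0 => u; exact: F0.
rewrite -lte_fin -fe; apply: lt_le_trans Hn _.
by apply: (ge0_subset_integral nu (mF n) (mF n.+1) (mf n.+1) (@F0 n.+1)); exact/subsetPset/FS.
Qed.

End Integrals.

(** * A bounded kernel of uniformly bounded mass *)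

Section TameKernel.
Variable R : realType.

(* The kernel [h'] is the derivative of [t |-> atan (t / (t^2 + y^2)^(1/4))],
   so it dominates [|t + iy|^(-1/2)] near 0 while having total mass at most [pi],
   whatever [y]. *)
Lemma tame_kernel (y : R) : 0 < y -> exists h h' : R -> R,
  [/\ forall t : R, is_derive t 1 h (h' t), continuous h',
      forall t, `|h t| <= 2,
      exists k, forall t, 0 <= h' t <= k &
      forall t s, y <= s -> s <= 1 ->
        1 <= (1 + 4 / Num.sqrt s * h' t) ^+ 2 * (t ^+ 2 + s ^+ 2)].
Proof.
move=> y0.
pose w t : R := t ^+ 2 + y ^+ 2.
pose n t := Num.sqrt (w t).
pose r t := Num.sqrt (n t).
have w0 t : 0 < w t by exact: sqrD_gt0.
have n0 t : 0 < n t by rewrite sqrtr_gt0.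
have r0 t : 0 < r t by rewrite sqrtr_gt0.
have r2 t : r t ^+ 2 = n t by rewrite sqr_sqrtr// ltW.
have r4 t : r t ^+ 4 = w t by rewrite (exprM _ 2 2) r2 sqr_sqrtr// ltW.
pose h' t := (t ^+ 2 + 2 * y ^+ 2) / (2 * r t ^+ 3 * (r t ^+ 2 + t ^+ 2)).
have dr (t : R) : is_derive t 1 r (t / (2 * r t ^+ 3)).
  have dw : is_derive t 1 w (2 * t).
    have -> : w = (id ^+ 2 + cst (y ^+ 2)) by apply/funext => u; rewrite /w !fctE.
    by apply: is_derive_eq; rewrite addr0 expr1 /GRing.scale /= mulr1.
  have dn := @is_derive1_comp R Num.sqrt w t _ _ (is_derive1_sqrt (w0 t)) dw.
  have := @is_derive1_comp R Num.sqrt n t _ _ (is_derive1_sqrt (n0 t)) dn.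
  congr (is_derive _ _ _ _).
  rewrite -/(n t) -/(r t) -r2; field.
  by rewrite gt_eqF.
pose h t := atan (t / r t).
have dh (t : R) : is_derive t 1 h (h' t).
  have dq : is_derive t 1 (fun s => s / r s) ((r t)^-1 - t ^+ 2 / (2 * r t ^+ 5)).
    have rn : r t != 0 by rewrite gt_eqF.
    have := is_deriveM (is_derive_id t 1) (is_deriveV rn (dr t)).
    congr (is_derive _ _ _ _); rewrite /GRing.scale /=; field.
    by rewrite gt_eqF.
  have := @is_derive1_comp R atan (fun s => s / r s) t _ _ (is_derive1_atan _) dq.
  congr (is_derive _ _ _ _); rewrite /h'.
  have -> : t ^+ 2 + 2 * y ^+ 2 = 2 * r t ^+ 4 - t ^+ 2 by rewrite r4 /w; ring.
  field.
  by rewrite !gt_eqF// ltr_pwDl ?sqr_ge0// exprn_gt0.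
have cr : continuous r.
  by move=> t; exact: is_derive_continuous (dr t).
have den0 t : 0 < 2 * r t ^+ 3 * (r t ^+ 2 + t ^+ 2).
  by rewrite !mulr_gt0 ?exprn_gt0// ltr_pwDl ?sqr_ge0// exprn_gt0.
have h'0 t : 0 <= h' t.
  rewrite divr_ge0 ?(ltW (den0 t))//.
  by have := sqr_ge0 t; have := sqr_ge0 y; lra.
exists h, h'; split => //.
- move=> t; apply: cvgM.
    apply: cvgD; last exact: cvg_cst.
    by apply: cvgM; exact: cvg_id.
  apply: cvgV; first by rewrite gt_eqF.
  apply: cvgM.
    apply: cvgM; first exact: cvg_cst.
    by apply: (@continuous_comp _ _ _ r (fun z => z ^+ 3)); [exact: cr|exact: exprn_continuous].
  apply: cvgD; last exact: exprn_continuous.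
  by apply: (@continuous_comp _ _ _ r (fun z => z ^+ 2)); [exact: cr|exact: exprn_continuous].
- move=> t; rewrite ler_norml.
  have := atan_ltpi2 (t / r t); have := atan_gtNpi2 (t / r t).
  by have := pihalf_lt2 R; rewrite -/(h t); lra.
- exists (Num.sqrt y)^-1 => t; rewrite h'0 /=.
  have ry : Num.sqrt y <= r t.
    rewrite ler_wsqrtr// -[leLHS](gtr0_norm y0) -sqrtr_sqr ler_wsqrtr//.
    by rewrite lerDr sqr_ge0.
  apply: (@le_trans _ _ (r t)^-1); last first.
    by rewrite lef_pV2// posrE ?sqrtr_gt0.
  rewrite /h' ler_pdivrMr ?den0//.
  rewrite [leRHS](_ : _ = 2 * r t ^+ 4 + 2 * r t ^+ 2 * t ^+ 2); last first.
    by field; rewrite gt_eqF.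
  rewrite r4 /w.
  have : 0 <= r t ^+ 2 * t ^+ 2 by rewrite mulr_ge0 ?sqr_ge0.
  by have := sqr_ge0 t; lra.
move=> t s ys s1.
have s0 : 0 < s := lt_le_trans y0 ys.
have q0 : 0 < Num.sqrt s by rewrite sqrtr_gt0.
have K0 : 0 <= 4 / Num.sqrt s * h' t by rewrite mulr_ge0// divr_ge0// ltW.
(* Where [|t| >= 1], the summand 1 of the majorant suffices. *)
have [t1|t1] := leP 1 (t ^+ 2).
  apply: (@le_trans _ _ (1 * t ^+ 2)); first by rewrite mul1r.
  apply: ler_pM => //; first by rewrite sqr_ge0.
    by rewrite -[leLHS](expr1n _ 2) ler_pXn2r ?nnegrE ?addr_ge0// lerDl.
  by rewrite lerDl sqr_ge0.
(* For [|t| < 1] one has [t^4 <= t^2 + y^2], so [r^2] dominates [t^2] in the denominator of [h'],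
   and [h'] is at least [1 / (4 r)]. *)
have tr : t ^+ 2 <= r t ^+ 2.
  rewrite r2 -[leLHS]ger0_norm ?sqr_ge0// -sqrtr_sqr ler_wsqrtr// /w.
  have : 0 <= t ^+ 2 * (1 - t ^+ 2) by rewrite mulr_ge0 ?sqr_ge0// subr_ge0 ltW.
  by have := sqr_ge0 y; lra.
have h'r : (4 * r t)^-1 <= h' t.
  have r40 : 0 < 4 * r t by rewrite mulr_gt0.
  rewrite /h' ler_pdivlMr ?den0// mulrC ler_pdivrMr//.
  have -> : 2 * r t ^+ 3 * (r t ^+ 2 + t ^+ 2) =
      2 * r t * (r t ^+ 4) + 2 * r t * (r t ^+ 2 * t ^+ 2) by ring.
  have : r t ^+ 2 * t ^+ 2 <= r t ^+ 2 * r t ^+ 2 by rewrite ler_wpM2l ?sqr_ge0.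
  rewrite -exprD r4 => H.
  have : 2 * r t * (r t ^+ 2 * t ^+ 2) <= 2 * r t * w t.
    by rewrite ler_wpM2l ?mulr_ge0 ?(ltW (r0 t)).
  have : 0 <= r t * t ^+ 2 by rewrite mulr_ge0 ?sqr_ge0 ?(ltW (r0 t)).
  have : 0 <= r t * y ^+ 2 by rewrite mulr_ge0 ?sqr_ge0 ?(ltW (r0 t)).
  rewrite /w; lra.
(* The square of [sqrt s * r] is [s * n], and both [s] and [n] are at most [sqrt (t^2 + s^2)], the
   latter because [y <= s]. A single kernel thus serves all heights [s] above [y]. *)
apply: (@le_trans _ _ ((Num.sqrt s * r t)^-1 ^+ 2 * (t ^+ 2 + s ^+ 2))).
  rewrite exprVn exprMn sqr_sqrtr ?(ltW s0)// r2 mulrC ler_pdivlMr ?mulr_gt0// mul1r.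
  have ts0 : 0 <= t ^+ 2 + s ^+ 2 by rewrite addr_ge0 ?sqr_ge0.
  rewrite -(@ler_pXn2r _ 2) ?nnegrE ?mulr_ge0 ?(ltW s0) ?(ltW (n0 t))//.
  rewrite exprMn sqr_sqrtr ?(ltW (w0 t))// [leRHS]expr2.
  apply: ler_pM; rewrite ?sqr_ge0 ?(ltW (w0 t))// ?lerDr ?sqr_ge0//.
  by rewrite /w lerD2l ler_pXn2r// nnegrE ltW.
rewrite ler_wpM2r ?addr_ge0 ?sqr_ge0//.
have K1 : 0 <= 1 + 4 / Num.sqrt s * h' t by rewrite addr_ge0.
have i0 : 0 <= (Num.sqrt s * r t)^-1 by rewrite invr_ge0 mulr_ge0// ltW.
rewrite ler_pXn2r ?nnegrE//.
apply: (@le_trans _ _ (4 / Num.sqrt s * h' t)); last by rewrite lerDr.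
apply: le_trans (ler_wpM2l _ h'r); last by rewrite divr_ge0 ?(ltW q0).
by rewrite le_eqVlt; apply/orP; left; apply/eqP; field; rewrite !gt_eqF.
Qed.

End TameKernel.

(** * Estimates for [- psi] from its representation *)

Section Representation.
Variable R : realType.
Variable nu : {finite_measure set (measurableTypeR R) -> \bar R}.
Variables alpha beta : R.
Hypothesis alpha_le0 : alpha <= 0.
Implicit Types x y u s t : R.

Local Notation integrable D f := (nu.-integrable D (EFin \o f)).

(* [- psi (x + iy) = rep_re x y + i rep_im x y] *)
Definition rep_re x y := - alpha * x - beta - \int[nu]_u re_kernel x y u.
Definition rep_im x y := - alpha * y + \int[nu]_u im_kernel x y u.

Local Notation mass := (fine (nu setT)).

Lemma mass_ge0 : 0 <= mass.
Proof. exact: fine_ge0. Qed.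

Lemma integrable_im_kernel x y D : measurable D -> 0 < y -> integrable D (im_kernel x y).
Proof.
move=> mD y0.
apply: (bounded_continuous_integrable nu (k := 2 * y + (1 + 2 * x ^+ 2) * y^-1) mD).
  exact: continuous_im_kernel.
move=> u _; rewrite ger0_norm ?im_kernel_ge0//.
by have [] := kernel_bounded x u y0.
Qed.

Lemma integrable_re_kernel x y D : measurable D -> 0 < y -> integrable D (re_kernel x y).
Proof.
move=> mD y0.
apply: (bounded_continuous_integrable nu (k := 3 * `|x| + y + (1 + x ^+ 2) * y^-1) mD).
  exact: continuous_re_kernel.
by move=> u _; have [] := kernel_bounded x u y0.
Qed.

Lemma Rintegral_cst_setT (k : R) : \int[nu]_u k = k * mass.
Proof. exact: Rintegral_cst. Qed.

Lemma rep_im_ge x y : 0 < y ->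
  - alpha * y + y / (2 * (1 + x ^+ 2 + y ^+ 2)) * mass <= rep_im x y.
Proof.
move=> y0; rewrite lerD2l -Rintegral_cst_setT.
apply: le_Rintegral => //; first exact: integrable_cst.
  exact: integrable_im_kernel.
by move=> u _; exact: im_kernel_ge.
Qed.

Lemma rep_im_ge_box e X Y x y : 0 < e -> `|x| <= X -> e <= y -> y <= Y ->
  e / (2 * (1 + X ^+ 2 + Y ^+ 2)) * mass <= rep_im x y.
Proof.
move=> e0 xX ey yY.
have y0 : 0 < y := lt_le_trans e0 ey.
have x2 : x ^+ 2 <= X ^+ 2.
  by rewrite -(real_normK (num_real x)) ler_pXn2r ?nnegrE// (le_trans _ xX).
have y2 : y ^+ 2 <= Y ^+ 2 by rewrite ler_pXn2r ?nnegrE ?(ltW y0) ?(le_trans (ltW y0)).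
have den : 0 < 2 * (1 + x ^+ 2 + y ^+ 2) by have := sqr_ge0 x; have := sqr_ge0 y; lra.
apply: le_trans (rep_im_ge x y0); rewrite -[leLHS]add0r; apply: lerD.
  by rewrite mulr_ge0 ?oppr_ge0// ltW.
apply: ler_wpM2r; first exact: mass_ge0.
apply: ler_pM => //; [exact: ltW|by rewrite invr_ge0; lra|].
by rewrite lef_pV2 ?posrE//; lra.
Qed.

Lemma rep_im_ge_set x y D : measurable D -> 0 < y ->
  \int[nu]_(u in D) im_kernel x y u <= rep_im x y.
Proof.
move=> mD y0; rewrite -[leLHS]add0r lerD//; first by rewrite mulr_ge0 ?oppr_ge0// ltW.
apply: le_Rintegral_set => //; first exact: integrable_im_kernel.
by move=> u; exact: im_kernel_ge0.
Qed.

Lemma rep_im_ge_alpha x y : 0 < y -> - alpha * y <= rep_im x y.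
Proof.
move=> y0; apply: le_trans (rep_im_ge x y0); rewrite lerDl mulr_ge0 ?mass_ge0//.
rewrite divr_ge0 ?(ltW y0)// mulr_ge0//.
by have := sqr_ge0 x; have := sqr_ge0 y; lra.
Qed.

Lemma rep_im_ge0 x y : 0 < y -> 0 <= rep_im x y.
Proof.
move=> y0; apply: le_trans (rep_im_ge_alpha x y0).
by rewrite mulr_ge0 ?oppr_ge0// ltW.
Qed.

(** The imaginary part is positive as soon as [alpha < 0] or [nu] is nonzero; otherwise [psi] is the
    constant [beta]. *)
Lemma rep_neq0 x y : 0 < y -> alpha < 0 \/ 0 < mass \/ beta != 0 ->
  rep_re x y ^+ 2 + rep_im x y ^+ 2 != 0.
Proof.
move=> y0 H; rewrite paddr_eq0 ?sqr_ge0// !sqrf_eq0 negb_and.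
have D0 : 0 < 2 * (1 + x ^+ 2 + y ^+ 2).
  by have := sqr_ge0 x; have := sqr_ge0 y; lra.
have [a0|a0] := ltP alpha 0.
  apply/orP; right; rewrite gt_eqF// (lt_le_trans _ (rep_im_ge_alpha x y0))//.
  by rewrite mulr_gt0// oppr_gt0.
have ae : alpha = 0 by apply/eqP; rewrite eq_le a0 alpha_le0.
have [m0|m0] := ltP 0 mass.
  apply/orP; right; rewrite gt_eqF// (lt_le_trans _ (rep_im_ge x y0))//.
  by rewrite ae oppr0 mul0r add0r mulr_gt0// divr_gt0.
have me : mass = 0 by apply/eqP; rewrite eq_le m0 mass_ge0.
case: H => [|[|b0]]; rewrite ?ae ?me ?ltxx//.
apply/orP; left; rewrite /rep_re ae oppr0 mul0r add0r.
have -> : \int[nu]_u re_kernel x y u = 0.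
  apply/eqP; rewrite -normr_le0.
  have [C HC] : exists C, forall u, `|re_kernel x y u| <= C.
    by exists (3 * `|x| + y + (1 + x ^+ 2) * y^-1) => u; have [] := kernel_bounded x u y0.
  have := @normr_Rintegral_le R nu setT (re_kernel x y) (fun=> C) measurableT.
  rewrite Rintegral_cst_setT me mulr0; apply => //.
    exact: integrable_re_kernel.
  exact: integrable_cst.
by rewrite subr0 oppr_eq0.
Qed.

(** Integrates [kernel_le] against [nu]. The constant is the same for all heights [s] and all
    majorants [J], so [J] may be adapted to the abscissa afterwards. *)
Lemma rep_le_of_majorant (a b : R) : exists2 C : R, 0 <= C &
  forall x s (J : R -> R), a <= x <= b -> 0 < s -> s <= 1 -> integrable setT J ->
    (forall u, 0 <= J u) ->
    (forall u, 1 <= J u ^+ 2 * ((x - u) ^+ 2 + s ^+ 2)) ->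
    `|rep_re x s| <= C * (1 + \int[nu]_u J u) /\
    `|rep_im x s| <= C * (1 + \int[nu]_u J u).
Proof.
pose A := `|a| + `|b|.
have A0 : 0 <= A by rewrite addr_ge0.
(* [K] absorbs every coefficient of [kernel_le] when [|x| <= A] and [s <= 1]. *)
pose K := 3 * A + 2 + 1 + 2 * A ^+ 2.
have K0 : 0 <= K by rewrite /K; have := sqr_ge0 A; lra.
pose C := `|alpha| * (A + 1) + `|beta| + K * mass + K.
have m0 := mass_ge0.
have C0 : 0 <= C.
  have h1 : 0 <= `|alpha| * (A + 1) by rewrite mulr_ge0// addr_ge0.
  have h2 : 0 <= K * mass by rewrite mulr_ge0.
  by have := normr_ge0 beta; rewrite /C; lra.
exists C => // x s J /andP[ax xb] s0 s1 iJ J0 HJ.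
have xA : `|x| <= A.
  rewrite /A ler_norml; have := ler_norm a; have := ler_norm b.
  have := ler_norm (- a); have := ler_norm (- b); rewrite !normrN.
  by have := normr_ge0 a; have := normr_ge0 b; lra.
have x2A : x ^+ 2 <= A ^+ 2.
  by rewrite -(real_normK (num_real x)) ler_pXn2r ?nnegrE.
have ks u : im_kernel x s u <= K + K * J u /\ `|re_kernel x s u| <= K + K * J u.
  have [h1 h2] := kernel_le s0 (J0 u) (HJ u).
  have := sqr_ge0 A => sA.
  have e1 : (1 + 2 * x ^+ 2) * J u <= K * J u by rewrite ler_wpM2r// /K; lra.
  have e2 : (1 + x ^+ 2) * J u <= K * J u.
    by rewrite ler_wpM2r// /K; have := sqr_ge0 x; lra.
  have e3 : 2 * s <= K by rewrite /K; lra.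
  have e4 : 3 * `|x| + s <= K by rewrite /K; lra.
  by split; lra.
have iJK : integrable setT (fun u => K * J u) by exact: integrable_scale.
have iKJ : integrable setT (fun u => K + K * J u).
  by apply: integrable_sum => //; exact: integrable_cst.
have KJ : \int[nu]_u (K + K * J u) = K * mass + K * \int[nu]_u J u.
  rewrite RintegralD//; last exact: integrable_cst.
  by rewrite Rintegral_cst_setT RintegralZl.
have IJ0 : 0 <= \int[nu]_u J u by apply: Rintegral_ge0.
have fin (e : R) : `|e| <= `|alpha| * (A + 1) + `|beta| + (K * mass + K * \int[nu]_u J u) ->
   `|e| <= C * (1 + \int[nu]_u J u).
  move=> /le_trans; apply.
  have h2 : 0 <= K * mass by rewrite mulr_ge0.
  have h1 : 0 <= `|alpha| * (A + 1) by rewrite mulr_ge0// addr_ge0.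
  have CE : `|alpha| * (A + 1) + `|beta| + K * mass + K = C by [].
  have KC : K * \int[nu]_u J u <= C * \int[nu]_u J u.
    by rewrite ler_wpM2r// -CE; have := normr_ge0 beta; lra.
  lra.
split; apply: fin.
  have h1 : `|\int[nu]_u re_kernel x s u| <= K * mass + K * \int[nu]_u J u.
    rewrite -KJ; apply: normr_Rintegral_le => //; first exact: integrable_re_kernel.
    by move=> u _; have [] := ks u.
  rewrite /rep_re.
  have := ler_normB (- alpha * x - beta) (\int[nu]_u re_kernel x s u).
  have := ler_normB (- alpha * x) beta.
  have : `|- alpha * x| <= `|alpha| * (A + 1).
    by rewrite normrM normrN ler_wpM2l//; lra.
  lra.
have h1 : `|\int[nu]_u im_kernel x s u| <= K * mass + K * \int[nu]_u J u.
  rewrite -KJ; apply: normr_Rintegral_le => //; first exact: integrable_im_kernel.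
  by move=> u _; have [k1 _] := ks u; rewrite ger0_norm//; exact: im_kernel_ge0.
rewrite /rep_im.
have := ler_normD (- alpha * s) (\int[nu]_u im_kernel x s u).
have : `|- alpha * s| <= `|alpha| * (A + 1).
  by rewrite normrM normrN ler_wpM2l// gtr0_norm//; lra.
have := normr_ge0 beta; lra.
Qed.

(* Averaging the tame kernel over [x] and applying the mean value theorem
   selects an abscissa along which [psi] grows at most like [s^(-1/2)]. *)
Lemma tame_abscissa (a b : R) : a < b -> exists2 C : R, 0 <= C &
  forall y, 0 < y -> y <= 1 -> exists2 x, a <= x <= b &
    forall s, y <= s -> s <= 1 ->
     `|rep_re x s| <= C * (1 + (Num.sqrt s)^-1) /\
     `|rep_im x s| <= C * (1 + (Num.sqrt s)^-1).
Proof.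
move=> ab; have [C C0 HC] := rep_le_of_majorant a b.
have m0 := mass_ge0.
have ba0 : 0 < b - a by rewrite subr_gt0.
(* The potential [F] below, with derivative the integral of [h' (x - u)], satisfies [|F| <= 2 mass];
   its mean slope over [[a, b]] is thus at most [L]. *)
pose L := 4 * mass / (b - a).
have L0 : 0 <= L by rewrite /L divr_ge0 ?(ltW ba0)// mulr_ge0.
exists (C * (1 + mass + 4 * L)).
  by rewrite mulr_ge0// !addr_ge0// mulr_ge0.
move=> y y0 y1.
have [h [h' [dh ch' h2 [k h'k] H]]] := tame_kernel y0.
have ch : continuous h by move=> t; exact: is_derive_continuous (dh t).
pose F x := \int[nu]_u h (x - u).
have shift (g : R -> R) x : continuous g -> continuous (fun u => g (x - u)).
  move=> cg u; apply: continuous_comp; last exact: cg.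
  by apply: cvgB; [exact: cvg_cst|exact: cvg_id].
have ih x : integrable setT (fun u => h (x - u)).
  by apply: (bounded_continuous_integrable nu (k := 2)) => //; exact: shift.
have ih' x : integrable setT (fun u => h' (x - u)).
  apply: (bounded_continuous_integrable nu (k := k)) => //; first exact: shift.
  by move=> u _; have /andP[? ?] := h'k (x - u); rewrite ger0_norm.
have dF (x : R) : is_derive x 1 F (\int[nu]_u h' (x - u)).
  apply: (is_derive_integral (g := fun=> k) (f := fun x u => h (x - u))
    (df := fun x u => h' (x - u)) (u := x - 1) (v := x + 1)) => //.
  - by apply/andP; split; lra.
  - move=> t u _ _.
    have d1 : is_derive t 1 (fun s : R => s - u) 1.
      have -> : (fun s : R => s - u) = (id - cst u) by apply/funext => s; rewrite !fctE.
      by apply: is_derive_eq; rewrite subr0.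
    have := @is_derive1_comp R h (fun s => s - u) t _ _ (dh _) d1.
    by rewrite mulr1.
  - by move=> u; have /andP[/le_trans] := h'k 0; apply.
  - exact: integrable_cst.
  - by move=> t u _ _; have /andP[? ?] := h'k (t - u); rewrite ger0_norm.
have [x xab FE] : exists2 x : R, x \in `[a, b] &
    F b - F a = (\int[nu]_u h' (x - u)) * (b - a).
  apply: (@MVT_segment R F (fun x => \int[nu]_u h' (x - u))) => //; first exact: ltW.
  by apply: (is_derive_within_continuous (df := fun x => \int[nu]_u h' (x - u))) => t _.
have Fle t : `|F t| <= 2 * mass.
  rewrite -Rintegral_cst_setT; apply: normr_Rintegral_le => //.
  exact: integrable_cst.
have Ih : \int[nu]_u h' (x - u) <= L.
  rewrite /L ler_pdivlMr// -FE.
  have := Fle a; have := Fle b; rewrite !ler_norml; lra.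
have Ih0 : 0 <= \int[nu]_u h' (x - u).
  by apply: Rintegral_ge0 => u _; have /andP[] := h'k (x - u).
exists x; first by move: xab; rewrite in_itv.
move=> s ys s1.
have s0 : 0 < s := lt_le_trans y0 ys.
have q0 : 0 < Num.sqrt s by rewrite sqrtr_gt0.
have q1 : 0 <= 4 / Num.sqrt s by rewrite divr_ge0// ltW.
pose J u := 1 + 4 / Num.sqrt s * h' (x - u).
have i1 : integrable setT (fun u => 4 / Num.sqrt s * h' (x - u)).
  exact: integrable_scale.
have iJ : integrable setT J.
  by apply: integrable_sum => //; exact: integrable_cst.
have J0 u : 0 <= J u.
  by rewrite addr_ge0// mulr_ge0//; have /andP[] := h'k (x - u).
have JE : \int[nu]_u J u <= mass + 4 * L * (Num.sqrt s)^-1.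
  rewrite /J RintegralD//; last exact: integrable_cst.
  rewrite Rintegral_cst_setT mul1r lerD2l RintegralZl//.
  by rewrite [leRHS]mulrAC; apply: ler_wpM2l.
have xab' : a <= x <= b by move: xab; rewrite in_itv.
have HJ u : 1 <= J u ^+ 2 * ((x - u) ^+ 2 + s ^+ 2) by exact: H.
have [r1 r2] := HC x s J xab' s0 s1 iJ J0 HJ.
have fin (e : R) : e <= C * (1 + \int[nu]_u J u) ->
    e <= C * (1 + mass + 4 * L) * (1 + (Num.sqrt s)^-1).
  move=> /le_trans; apply; rewrite -mulrA ler_wpM2l//.
  have i0 : 0 <= (Num.sqrt s)^-1 by rewrite invr_ge0 ltW.
  have : 0 <= (1 + mass) * (Num.sqrt s)^-1 by rewrite mulr_ge0// addr_ge0.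
  lra.
by split; apply: fin.
Qed.

End Representation.

(** * The part of [V] due to the measure on a set of finite second moment *)

Section ArctanPotential.
Variable R : realType.
Variable nu : {finite_measure set (measurableTypeR R) -> \bar R}.
Variable D : set (measurableTypeR R).
Hypothesis mD : measurable D.
Local Notation integrable D f := (nu.-integrable D (EFin \o f)).
Hypothesis iw : integrable D (fun u : R => 1 + u ^+ 2).
Implicit Types x y u : R.

(** Up to an additive constant, the imaginary part of minus the integral of [(1 + u^2) log (z - u)]:
    the contribution of [D] to [V], without its term linear in [y]. It is bounded on the half-plane
    uniformly in [y]. *)
Definition atan_potential x y := \int[nu]_(u in D) ((1 + u ^+ 2) * atan ((x - u) / y)).

Lemma weighted_atan_le x y u : `|(1 + u ^+ 2) * atan ((x - u) / y)| <= 2 * (1 + u ^+ 2).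
Proof.
rewrite normrM (ger0_norm (one_sqr_ge0 u)) mulrC.
by apply: ler_wpM2r; [exact: one_sqr_ge0|exact: normr_atan_le2].
Qed.

Lemma integrable_weighted_atan x y : integrable D (fun u => (1 + u ^+ 2) * atan ((x - u) / y)).
Proof.
apply: (continuous_integrable mD (g := fun u => 2 * (1 + u ^+ 2))).
- move=> u; apply: cvgM; first exact: continuous_one_sqr.
  apply: (@continuous_comp _ _ _ (fun u => (x - u) / y) atan).
    apply: cvgM; last exact: cvg_cst.
    by apply: cvgB; [exact: cvg_cst|exact: cvg_id].
  exact: continuous_atan.
- exact: integrable_scale.
- by move=> u _; exact: weighted_atan_le.
Qed.

Lemma normr_atan_potential x y :
  `|atan_potential x y| <= 2 * \int[nu]_(u in D) (1 + u ^+ 2).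
Proof.
rewrite -RintegralZl//; apply: normr_Rintegral_le => //.
- exact: integrable_weighted_atan.
- exact: integrable_scale.
- by move=> u _; exact: weighted_atan_le.
Qed.

Lemma is_derive_atan_potential_x x y : 0 < y ->
  is_derive x 1 (atan_potential ^~ y) (\int[nu]_(u in D) im_kernel x y u).
Proof.
move=> y0.
apply: (is_derive_integral (g := fun u => y^-1 * (1 + u ^+ 2))
  (f := fun x u => (1 + u ^+ 2) * atan ((x - u) / y))
  (df := fun x u => im_kernel x y u) (u := x - 1) (v := x + 1)) => //.
- by apply/andP; split; lra.
- by move=> t _; exact: integrable_weighted_atan.
- move=> t u _ _; exact: (is_deriveZ (1 + u ^+ 2) (is_derive_atan_x t u y0)).
- by move=> u; rewrite mulr_ge0 ?one_sqr_ge0// invr_ge0 ltW.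
- exact: integrable_scale.
- move=> t u _ _; rewrite ger0_norm ?im_kernel_ge0// /im_kernel mulrC.
  apply: ler_wpM2r; first exact: one_sqr_ge0.
  rewrite ler_pdivrMr ?sqrD_gt0// ler_pdivlMl// -expr2 lerDr.
  exact: sqr_ge0.
Qed.

Lemma is_derive_atan_potential_y x y : 0 < y ->
  is_derive y 1 (atan_potential x)
    (- \int[nu]_(u in D) ((1 + u ^+ 2) * ((x - u) / ((x - u) ^+ 2 + y ^+ 2)))).
Proof.
move=> y0.
pose df z u := (1 + u ^+ 2) * (- ((x - u) / ((x - u) ^+ 2 + z ^+ 2))).
(* Staying above [y / 2] lets one multiple of [1 + u^2] dominate all the derivatives near [y]. *)
have bnd z u : y / 2 < z -> `|df z u| <= (y / 2)^-1 * (1 + u ^+ 2).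
  move=> yz; have z0 : 0 < z by apply: lt_trans yz; rewrite divr_gt0.
  rewrite /df normrM (ger0_norm (one_sqr_ge0 u)) mulrC.
  apply: ler_wpM2r; first exact: one_sqr_ge0.
  rewrite normrN normrM normfV (gtr0_norm (sqrD_gt0 _ z0)).
  rewrite ler_pdivrMr ?sqrD_gt0// ler_pdivlMl ?divr_gt0//.
  have h : y / 2 * `|x - u| <= z * `|x - u| by rewrite ler_wpM2r// ltW.
  apply: le_trans h _; rewrite -(real_normK (num_real (x - u))).
  have := sqr_ge0 (z - `|x - u|); have := sqr_ge0 z; have := sqr_ge0 `|x - u|.
  lra.
have iy : integrable D (fun u => (y / 2)^-1 * (1 + u ^+ 2)) by exact: integrable_scale.
have cdf : continuous (fun u => (1 + u ^+ 2) * ((x - u) / ((x - u) ^+ 2 + y ^+ 2))).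
  move=> u; apply: cvgM; first exact: continuous_one_sqr.
  apply: cvgM; last exact: continuous_inv_sqrD.
  by apply: cvgB; [exact: cvg_cst|exact: cvg_id].
have -> : - (\int[nu]_(u in D) ((1 + u ^+ 2) * ((x - u) / ((x - u) ^+ 2 + y ^+ 2)))) =
    \int[nu]_(u in D) df y u.
  rewrite -mulN1r -RintegralZl//; last first.
    apply: (continuous_integrable mD cdf iy) => u _.
    have /(bnd y u) : y / 2 < y by lra.
    by rewrite /df !normrM normrN normrM.
  by apply: eq_Rintegral => u _; rewrite /df mulN1r mulrN.
have yI : y / 2 < y < y + 1 by apply/andP; split; lra.
have dd (t u : R) : y / 2 < t < y + 1 -> D u ->
    is_derive t 1 (fun z => (1 + u ^+ 2) * atan ((x - u) / z)) (df t u).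
  move=> /andP[yt _] _.
  have t0 : 0 < t by apply: lt_trans yt; rewrite divr_gt0.
  exact: (is_deriveZ (1 + u ^+ 2) (is_derive_atan_y (x - u) t0)).
have g0 u : 0 <= (y / 2)^-1 * (1 + u ^+ 2).
  by rewrite mulr_ge0 ?one_sqr_ge0// invr_ge0 divr_ge0 ?(ltW y0).
exact: (is_derive_integral mD yI (fun t _ => integrable_weighted_atan x t) dd g0 iy
  (fun t u ht _ => bnd t u (andP ht).1)).
Qed.

End ArctanPotential.

(** * Boundary behaviour of the primitive *)

Lemma bounded_sequence_cvg_subseq (R : realType) (a b : nat -> R) (B : R) :
  (forall n, `|a n| <= B) -> (forall n, `|b n| <= B) ->
  exists (l m : R) (f : nat -> nat), [/\ forall n, (n <= f n)%N,
    a (f n) @[n --> \oo] --> l & b (f n) @[n --> \oo] --> m].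
Proof.
move=> aB bB.
have bnd (u : nat -> R) : (forall n, `|u n| <= B) -> bounded_fun u.
  move=> uB; exists B; split; first exact: num_real.
  by move=> M BM n _ /=; exact: le_trans (uB n) (ltW BM).
have inc_ge (f : nat -> nat) : increasing_seq f -> forall n, (n <= f n)%N.
  move=> /increasing_seqP incf; elim=> // n IH; apply: leq_ltn_trans IH _; exact: incf.
have [f incf cf] := bolzano_weierstrass (bnd a aB).
have [g incg cg] := bolzano_weierstrass (bnd (b \o f) (fun n => bB (f n))).
exists (limn (a \o f)), (limn (b \o f \o g)), (f \o g); split => //.
  by move=> n /=; apply: (leq_trans (inc_ge g incg n)); exact: inc_ge.
apply: (@cvg_comp _ _ _ g (a \o f) _ \oo) => //.
move=> A [N _ NA]; exists N => // n /= Nn; apply: NA => /=.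
exact: leq_trans Nn (inc_ge g incg n).
Qed.

Section Primitive.
Variable R : realType.
Variable nu : {finite_measure set (measurableTypeR R) -> \bar R}.
Variables alpha beta : R.
Hypothesis alpha_le0 : alpha <= 0.
Local Notation integrable D f := (nu.-integrable D (EFin \o f)).
Local Notation mass := (fine (nu setT)).
Implicit Types x y u : R.
Local Notation p := (rep_re nu alpha beta).
Local Notation q := (rep_im nu alpha).

Variables U V : R -> R -> R.
Hypothesis dU : forall x y a b t : R, 0 < y + t * b ->
  is_derive t 1 (fun s => U (x + s * a) (y + s * b))
    (p (x + t * a) (y + t * b) * a - q (x + t * a) (y + t * b) * b).
Hypothesis dV : forall x y a b t : R, 0 < y + t * b ->
  is_derive t 1 (fun s => V (x + s * a) (y + s * b))
    (q (x + t * a) (y + t * b) * a + p (x + t * a) (y + t * b) * b).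

Let q_ge0 x y : 0 < y -> 0 <= q x y.
Proof. exact: rep_im_ge0. Qed.

Let dUx x y (y0 : 0 < y) := (is_derive_horizontal dU dV x y0).1.
Let dVx x y (y0 : 0 < y) := (is_derive_horizontal dU dV x y0).2.
Let dUy x y (y0 : 0 < y) := (is_derive_vertical dU dV x y0).1.
Let dVy x y (y0 : 0 < y) := (is_derive_vertical dU dV x y0).2.
Let V_mono x0 x1 y : 0 < y -> x0 <= x1 -> V x0 y <= V x1 y.
Proof. exact: (V_nondecreasing dU dV q_ge0). Qed.

(** The bound [s^(-1/2)] is integrable at 0, so descending from height 1 to [y] above the tame
    abscissa changes [U] and [V] by a quantity independent of [y]. Height 1 itself is reached
    horizontally from [(a, 1)]. *)
Lemma good_abscissa (a b : R) : a < b -> exists C : R, forall y, 0 < y -> y <= 1 ->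
  exists2 x, a <= x <= b & `|U x y| <= C /\ `|V x y| <= C.
Proof.
move=> ab.
have [C1 C10 H1] := tame_abscissa nu alpha beta ab.
have [C2 C20 H2] := rep_le_of_majorant nu alpha beta a b.
have m0 : 0 <= mass := mass_ge0 nu.
pose E := C2 * (1 + mass) * (b - a) + `|U a 1| + `|V a 1|.
exists (E + C1 * 3) => y y0 y1.
have [x /andP[ax xb] Hx] := H1 y y0 y1.
exists x; first by rewrite ax.
(* At height 1 the constant 1 already majorises [1 / |z - u|]. *)
have base t : a <= t <= x -> `|p t 1| <= C2 * (1 + mass) /\ `|q t 1| <= C2 * (1 + mass).
  move=> /andP[at_ tx].
  have := H2 t 1 (fun=> 1); rewrite Rintegral_cst_setT mul1r; apply => //.
  - by rewrite at_ (le_trans tx).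
  - exact: integrable_cst.
  - by move=> u; rewrite expr1n mul1r lerDr sqr_ge0.
have dlin (c t : R) : is_derive t 1 (fun s => c * s) c.
  have -> : (fun s => c * s) = (c *: id) by apply/funext => s; rewrite !fctE.
  by apply: is_derive_eq; rewrite /GRing.scale /= mulr1.
have hU1 : `|U x 1 - U a 1| <= C2 * (1 + mass) * (b - a).
  apply: (@le_trans _ _ (C2 * (1 + mass) * x - C2 * (1 + mass) * a)).
    apply: (normr_increment_le (df := p ^~ 1) (dg := fun=> C2 * (1 + mass)) ax
      (g := fun s => C2 * (1 + mass) * s) (f := U ^~ 1)).
    - by move=> t _; exact: dUx.
    - by move=> t /base[].
  by rewrite -mulrBr ler_wpM2l ?mulr_ge0 ?addr_ge0// lerB.
have hV1 : `|V x 1 - V a 1| <= C2 * (1 + mass) * (b - a).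
  apply: (@le_trans _ _ (C2 * (1 + mass) * x - C2 * (1 + mass) * a)).
    apply: (normr_increment_le (df := q ^~ 1) (dg := fun=> C2 * (1 + mass)) ax
      (g := fun s => C2 * (1 + mass) * s) (f := V ^~ 1)).
    - by move=> t _; exact: dVx.
    - by move=> t /base[].
  by rewrite -mulrBr ler_wpM2l ?mulr_ge0 ?addr_ge0// lerB.
(* A primitive of the bound on the vertical derivatives; its total increase over []0, 1]] is
   [3 C1]. *)
pose g s := C1 * (s + 2 * Num.sqrt s).
have dg (s : R) : y <= s <= 1 -> is_derive s 1 g (C1 * (1 + (Num.sqrt s)^-1)).
  move=> /andP[ys _]; have s0 : 0 < s := lt_le_trans y0 ys.
  have := is_deriveZ C1 (is_deriveD (is_derive_id s 1) (is_deriveZ 2 (is_derive1_sqrt s0))).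
  congr (is_derive _ _ _ _); rewrite /GRing.scale /=; field.
  by rewrite gt_eqF// sqrtr_gt0.
have g3 : g 1 - g y <= C1 * 3.
  rewrite /g sqrtr1 -mulrBr ler_wpM2l//; have := sqrtr_ge0 y; lra.
have ypos s : y <= s <= 1 -> 0 < s by move=> /andP[ys _]; exact: lt_le_trans ys.
have hU : `|U x 1 - U x y| <= C1 * 3.
  apply: le_trans g3; apply: (normr_increment_le y1 (fun s h => dUy x (ypos s h)) dg).
  by move=> s /andP[ys s1]; rewrite normrN; have [] := Hx s ys s1.
have hV : `|V x 1 - V x y| <= C1 * 3.
  apply: le_trans g3; apply: (normr_increment_le y1 (fun s h => dVy x (ypos s h)) dg).
  by move=> s /andP[ys s1]; have [] := Hx s ys s1.
have tri (A B C e1 e2 : R) : `|A - B| <= e1 -> `|A - C| <= e2 -> `|B| <= e1 + e2 + `|C|.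
  move=> h1 h2; have -> : B = C + (A - C) - (A - B) by ring.
  have := ler_normB (C + (A - C)) (A - B); have := ler_normD C (A - C); lra.
have := tri _ _ _ _ _ hU hU1; have := tri _ _ _ _ _ hV hV1.
by split; rewrite /E; have := normr_ge0 (U a 1); have := normr_ge0 (V a 1); lra.
Qed.

Lemma V_increment_ge (D : set (measurableTypeR R)) x0 x1 y : measurable D ->
  integrable D (fun u => 1 + u ^+ 2) -> 0 < y -> x0 <= x1 ->
  atan_potential nu D x1 y - atan_potential nu D x0 y <= V x1 y - V x0 y.
Proof.
move=> mD iw y0 x01.
apply: (derive_le_increment (f := atan_potential nu D ^~ y) (g := V ^~ y) x01).
- by move=> t _; exact: is_derive_atan_potential_x.
- by move=> t _; exact: dVx.
- by move=> t _; exact: rep_im_ge_set.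
Qed.

(** * Upper bounds on [V] when the right second moment is finite *)

Section LightRightTail.
Let D : set (measurableTypeR R) := `[0, +oo[.
Hypothesis iw : integrable D (fun u => 1 + u ^+ 2).

Let mD : measurable D.
Proof. exact: measurable_itv. Qed.

Local Notation G := (atan_potential nu D).
Local Notation w := (2 * \int[nu]_(u in D) (1 + u ^+ 2)).

Let inD u : (u \in D) = (0 <= u).
Proof. by apply/idP/idP => [/set_mem|h]; [|apply/mem_set]; rewrite /D /= in_itv /= andbT. Qed.

(** For [u < 0] and [x >= 1], [(x - u)^2 >= 1 + u^2], so the kernel is at most [y]: seen from the
    right, the left half of the measure contributes at most [mass * y]. *)
Lemma rep_im_le_right x y : 1 <= x -> 0 < y ->
  q x y - \int[nu]_(u in D) im_kernel x y u <= (- alpha + mass) * y.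
Proof.
move=> x1 y0; rewrite /rep_im.
suff : \int[nu]_u im_kernel x y u <= y * mass + \int[nu]_(u in D) im_kernel x y u by lra.
have iD : integrable D (im_kernel x y) by exact: integrable_im_kernel.
have iDT : integrable setT (im_kernel x y \_ D).
  have := iD; rewrite (integrable_mkcond _ mD).
  by apply: eq_integrable => // u _; rewrite /= /patch; case: ifP.
rewrite [\int[nu]_(u in D) _]Rintegral_mkcond -(Rintegral_cst_setT nu y).
rewrite -RintegralD//; last exact: integrable_cst.
apply: le_Rintegral => //; first exact: integrable_im_kernel.
  by apply: integrable_sum => //; exact: integrable_cst.
move=> u _; rewrite /patch inD /=.
case: (leP 0 u) => u0; first by rewrite lerDr ltW.
rewrite [leRHS](_ : _ = y); last exact: addr0.
rewrite /im_kernel mulrCA ler_piMr ?(ltW y0)//.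
rewrite ler_pdivrMr ?sqrD_gt0// mul1r.
have h : 0 <= - u * (x - 1) by rewrite mulr_ge0 ?subr_ge0// oppr_ge0 ltW.
have h1 : 1 <= x ^+ 2 by rewrite -[leLHS](expr1n _ 2) ler_pXn2r ?nnegrE//; lra.
by have := sqr_ge0 y; lra.
Qed.

Lemma V_le_right x y : 1 <= x -> 0 < y ->
  V x y <= V 1 y + 2 * w + x * y * (- alpha + mass).
Proof.
move=> x1 y0.
pose c := (- alpha + mass) * y.
have c0 : 0 <= c.
  by rewrite mulr_ge0 ?(ltW y0)// addr_ge0 ?oppr_ge0// mass_ge0.
have dlin (t : R) : is_derive t 1 (fun s => G s y + c * s)
    (\int[nu]_(u in D) im_kernel t y u + c).
  have := is_deriveD (is_derive_atan_potential_x mD iw t y0) (is_deriveZ c (is_derive_id t 1)).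
  by congr (is_derive _ _ _ _); rewrite /GRing.scale /= mulr1.
have := derive_le_increment (f := V ^~ y) x1 (fun t _ => dVx t y0) (fun t _ => dlin t).
have h t : 1 <= t <= x -> q t y <= \int[nu]_(u in D) im_kernel t y u + c.
  by move=> /andP[t1 _]; have := rep_im_le_right t1 y0; rewrite /c; lra.
move=> /(_ h).
have := normr_atan_potential mD iw x y; have := normr_atan_potential mD iw 1 y.
rewrite !ler_norml /c; rewrite /c in c0; lra.
Qed.

(** Monotonicity in [x] carries the bound at the selected abscissa of [[1, 2]] back to abscissa 1,
    where [V_le_right] starts. The error is proportional to [X * y], so the bound stays uniform as
    long as [y <= 1 / X], however large [X] is. *)
Lemma V_le_near_boundary : exists M K : R, 0 <= K /\ forall X x y, 1 <= X -> x <= X ->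
  0 < y -> y <= 1 -> V x y <= M + X * y * K.
Proof.
have [C HC] := good_abscissa (ltr1n R 2).
exists (C + 2 * w), (- alpha + mass); split.
  by rewrite addr_ge0 ?oppr_ge0// mass_ge0.
move=> X x y X1 xX y0 y1.
have [x' /andP[x'1 _] [_ hV]] := HC y y0 y1.
apply: le_trans (V_mono y0 xX) _.
apply: le_trans (V_le_right X1 y0) _; rewrite lerD2r lerD2r.
apply: le_trans (V_mono y0 x'1) _.
exact: le_trans (ler_norm _) hV.
Qed.

(** At abscissa [X >= 0] the masses at [u < 0] contribute negatively to [p], and so does the
    nonnegative mean. Hence [V] rises along the vertical line no faster than the bounded arctangent
    potential of the right half. *)
Lemma V_bounded_above : alpha = 0 -> integrable setT (fun u => u) ->
  0 <= beta + \int[nu]_u u -> exists C, forall x y, 0 < y -> V x y <= C.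
Proof.
move=> a0 iu b0.
have [M [K [K0 HM]]] := V_le_near_boundary.
have w0 : 0 <= w.
  by rewrite mulr_ge0//; apply: Rintegral_ge0 => u _; exact: one_sqr_ge0.
exists (M + K + 2 * w) => x y y0.
(* Moving right only increases [V]. With [X >= y^-1] the point [(X, 1/X)] lies below height [y], and
   there [X z = 1] bounds [V] by [M + K]. *)
pose X := Num.max (Num.max x 1) y^-1.
have X1 : 1 <= X by rewrite !le_max lexx orbT.
have xX : x <= X by rewrite !le_max lexx.
have Xy : y^-1 <= X by rewrite le_max lexx orbT.
have X0 : 0 < X := lt_le_trans ltr01 X1.
pose z := X^-1.
have z0 : 0 < z by rewrite invr_gt0.
have z1 : z <= 1 by rewrite invf_le1.
have zy : z <= y by rewrite -[y]invrK lef_pV2// posrE// invr_gt0.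
have Xz : X * z = 1 by rewrite divff// gt_eqF.
have VXz : V X z <= M + K by have := HM X X z X1 (lexx _) z0 z1; rewrite Xz mul1r.
apply: le_trans (V_mono y0 xX) _.
have zpos (t : R) : z <= t <= y -> 0 < t by move=> /andP[zt _]; exact: lt_le_trans zt.
have := derive_le_increment (f := V X) (g := G X) zy
  (fun t zt => dVy X (zpos t zt)) (fun t zt => is_derive_atan_potential_y mD iw X (zpos t zt)).
have h t : z <= t <= y -> p X t <=
    - \int[nu]_(u in D) ((1 + u ^+ 2) * ((X - u) / ((X - u) ^+ 2 + t ^+ 2))).
  move=> /zpos t0.
  pose f u := (1 + u ^+ 2) * ((X - u) / ((X - u) ^+ 2 + t ^+ 2)).
  have iD : integrable D f.
    apply: (continuous_integrable mD (g := fun u => t^-1 * (1 + u ^+ 2))).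
    - move=> u; apply: cvgM; first exact: continuous_one_sqr.
      apply: cvgM; last exact: continuous_inv_sqrD.
      by apply: cvgB; [exact: cvg_cst|exact: cvg_id].
    - exact: integrable_scale.
    - move=> u _; rewrite /f normrM (ger0_norm (one_sqr_ge0 u)) mulrC.
      apply: ler_wpM2r; first exact: one_sqr_ge0.
      rewrite normrM normfV (gtr0_norm (sqrD_gt0 _ t0)).
      rewrite ler_pdivrMr ?sqrD_gt0// ler_pdivlMl//.
      rewrite -(real_normK (num_real (X - u))).
      have := sqr_ge0 (t - `|X - u|); have := sqr_ge0 t; have := sqr_ge0 `|X - u|.
      lra.
  have iDT : integrable setT (f \_ D).
    have := iD; rewrite (integrable_mkcond _ mD).
    by apply: eq_integrable => // u _; rewrite /= /patch; case: ifP.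
  rewrite /rep_re a0 oppr0 mul0r -/f.
  suff : \int[nu]_u u + \int[nu]_(u in D) f u <= \int[nu]_u re_kernel X t u by lra.
  rewrite [\int[nu]_(u in D) _]Rintegral_mkcond -RintegralD//.
  apply: le_Rintegral => //; [exact: integrable_sum|exact: integrable_re_kernel|].
  move=> u _; rewrite /patch inD /re_kernel lerD2l -/(f u).
  case: (leP 0 u) => // u0; rewrite /f mulr_ge0 ?one_sqr_ge0// divr_ge0 ?(ltW (sqrD_gt0 _ t0))//.
  by lra.
move=> /(_ h).
have := normr_atan_potential mD iw X y; have := normr_atan_potential mD iw X z.
by rewrite !ler_norml; lra.
Qed.

End LightRightTail.

(* A finite cluster value of [U + iV] along points approaching the real axis is
   not attained: strict slope monotonicity keeps the values at such points away
   from the value at an interior point. *)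
Lemma heavy_right_tail_not_onto (M : R) :
  (forall c : R, exists2 N : R, 0 < N &
     c < \int[nu]_(u in (`[0, +oo[ : set (measurableTypeR R)) `&` `[- N, N]) (u ^+ 2)) ->
  ~ (forall a b, M < b -> exists x y, [/\ 0 < y, U x y = a & V x y = b]).
Proof.
move=> Hu onto.
have lt21 : -2 < -1 :> R by lra.
have [C1 HC1] := good_abscissa lt21.
(* The masses in [[0, N]] separate [[-2, -1]] from [[N + 1, N + 2]]. Crossing them adds more than
   this threshold to a value of [V] at least [- C1], which ends above [M + 1]. *)
have [N N0 HN] := Hu (`|C1| + `|M| + 1).
set D : set (measurableTypeR R) := _ `&` _ in HN.
have mD : measurable D by apply: measurableI; exact: measurable_itv.
have DN u : D u -> 0 <= u <= N.
  by move=> [] /=; rewrite !in_itv /= andbT => -> /andP[].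
have iw : integrable D (fun u => 1 + u ^+ 2).
  apply: (bounded_continuous_integrable nu (k := 1 + N ^+ 2) mD).
    exact: continuous_one_sqr.
  move=> u /DN /andP[u0 uN]; rewrite ger0_norm ?one_sqr_ge0// lerD2l.
  by rewrite ler_pXn2r ?nnegrE// (le_trans u0).
have isq : integrable D (fun u => u ^+ 2).
  apply: (continuous_integrable mD _ iw); first exact: exprn_continuous.
  by move=> u _; rewrite ger0_norm ?sqr_ge0// lerDr.
(* Needed for a positive lower bound on [q]: with zero mass the integral in [HN] would vanish. *)
have mass0 : 0 < mass.
  rewrite lt_neqAle mass_ge0 andbT; apply/negP => /eqP m0.
  have : \int[nu]_(u in D) (u ^+ 2) <= N ^+ 2 * mass.
    apply: (@le_trans _ _ (\int[nu]_(u in D) (N ^+ 2))).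
      apply: le_Rintegral => //; first exact: integrable_cst.
      move=> u /DN /andP[u0 uN]; by rewrite ler_pXn2r ?nnegrE// (le_trans u0).
    rewrite -(Rintegral_cst_setT nu); apply: le_Rintegral_set => //.
      exact: integrable_cst.
    by move=> _; exact: sqr_ge0.
  rewrite -m0 mulr0; have := normr_ge0 C1; have := normr_ge0 M; lra.
have lt_N : N + 1 < N + 2 by lra.
have [C2 HC2] := good_abscissa lt_N.
have seq_ n : exists z : R * R, [/\ N + 1 <= z.1 <= N + 2, z.2 = n.+1%:R^-1,
    `|U z.1 z.2| <= C2, `|V z.1 z.2| <= C2 & M + 1 <= V z.1 z.2].
  pose y : R := n.+1%:R^-1.
  have y0 : 0 < y by rewrite invr_gt0 ltr0n.
  have y1 : y <= 1 by rewrite invf_le1 ?ltr0n// ler1n.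
  have [x xI [hU hV]] := HC2 y y0 y1.
  have [x' x'I [_ hV']] := HC1 y y0 y1.
  exists (x, y); split => //=.
  have /andP[h1 h2] := xI; have /andP[h3 h4] := x'I.
  have x'x : x' <= x by lra.
  have H := V_increment_ge mD iw y0 x'x.
  (* Since [y <= 1], the two arguments are at least 1 and at most -1, so the jump is at least
     [pi / 2]. *)
  have atan_ge u : D u -> 1 <= atan ((x - u) / y) - atan ((x' - u) / y).
    move=> /DN /andP[u0 uN].
    have a1 : atan 1 <= atan ((x - u) / y).
      by apply: le_atan; rewrite ler_pdivlMr// mul1r; lra.
    have a2 : atan ((x' - u) / y) <= atan (- 1).
      by apply: le_atan; rewrite ler_pdivrMr// mulN1r; lra.
    move: a2; rewrite atanN atan1 => a2; rewrite atan1 in a1.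
    by have := pi_ge2 R; lra.
  have : \int[nu]_(u in D) (u ^+ 2) <= atan_potential nu D x y - atan_potential nu D x' y.
    rewrite /atan_potential -RintegralB//; try exact: integrable_weighted_atan.
    apply: le_Rintegral => //.
      have := integrableB mD (integrable_weighted_atan mD iw x y)
        (integrable_weighted_atan mD iw x' y).
      by apply: eq_integrable => // u _; rewrite /= EFinB.
    move=> u Du; rewrite -mulrBr -[leLHS]mulr1.
    apply: ler_pM => //; [exact: sqr_ge0|by rewrite lerDr|exact: atan_ge].
  move: hV'; rewrite ler_norml => /andP[hV' _].
  have := ler_norm C1; have := ler_norm M; lra.
have [z Hz] := choice seq_.
have [a [b [f [fn ca cb]]]] := @bounded_sequence_cvg_subseq R
  (fun n => U (z n).1 (z n).2) (fun n => V (z n).1 (z n).2) C2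
  (fun n => let: And5 _ _ h _ _ := Hz n in h) (fun n => let: And5 _ _ _ h _ := Hz n in h).
have bM : M + 1 <= b.
  apply: (cvgr_to_ge cb).
  by apply: nearW => n; have [] := Hz (f n).
have Mb : M < b by apply: lt_le_trans bM; rewrite ltrDl.
have [x0 [y0 [y0p Ux Vx]]] := onto a b Mb.
pose X := 2 * `|x0| + (N + 2).
have X0 : 0 <= X by rewrite /X !addr_ge0 ?mulr_ge0// ltW.
have den0 : 0 < 2 * (1 + X ^+ 2 + y0 ^+ 2).
  by rewrite mulr_gt0// ltr_wpDr ?sqr_ge0// ltr_wpDr ?sqr_ge0.
(* Lower bound for [q] on the first half of every segment from [(x0, y0)] to a late point of the
   sequence; [X] bounds the abscissas met there. *)
pose c := y0 / 2 / (2 * (1 + X ^+ 2 + y0 ^+ 2)) * mass.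
have c0 : 0 < c by rewrite mulr_gt0// divr_gt0// divr_gt0.
(* [slope_dist] over half a segment of height at least [y0 / 2] yields
   [c y0 / 4 <= 2 (|dU| + |dV|)], which fails once both differences are below [c y0 / 16]. *)
have e0 : 0 < c * y0 / 16 by rewrite divr_gt0// mulr_gt0.
have /cvgrPdist_lt /(_ _ e0) [n1 _ H1] := ca.
have /cvgrPdist_lt /(_ _ e0) [n2 _ H2] := cb.
pose n := maxn (maxn n1 n2) (Num.truncn (2 / y0)).
have {}H1 := H1 n (leq_trans (leq_maxl _ _) (leq_maxl _ _)).
have {}H2 := H2 n (leq_trans (leq_maxr _ _) (leq_maxl _ _)).
have [zI zy _ _ _] := Hz (f n).
set x := (z (f n)).1 in H1 H2 zI; set y := (z (f n)).2 in H1 H2 zy.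
have yp : 0 < y by rewrite zy invr_gt0 ltr0n.
have yle : y <= y0 / 2.
  rewrite zy -[y0 / 2]invrK invf_div lef_pV2 ?posrE ?ltr0n// ?divr_gt0//.
  apply: (@le_trans _ _ (Num.truncn (2 / y0)).+1%:R); first exact/ltW/truncnS_gt.
  by rewrite ler_nat ltnS; apply: leq_trans (fn n); exact: leq_maxr.
have seg t : 0 <= t <= 2^-1 -> c <= q (x0 + t * (x - x0)) (y0 + t * (y - y0)).
  move=> t01; have [yt1 yt2 xt] := half_segment_bounds x0 x t01 yp yle.
  apply: rep_im_ge_box => //; first by rewrite divr_gt0.
  apply: (le_trans xt); rewrite lerD2l.
  have /andP[z1 z2] := zI; rewrite ger0_norm//; apply: le_trans z1.
  by rewrite addr_ge0// ltW.
have half : (0 : R) <= 2^-1 by rewrite invr_ge0.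
have half1 : 2^-1 <= (1 : R) by rewrite invf_le1// ler1n.
have := slope_dist dU dV q_ge0 (lexx 0) half half1 y0p yp (ltW c0) seg.
rewrite subr0 Ux Vx.
have hy : y0 / 2 <= `|y - y0|.
  by rewrite distrC (le_trans _ (ler_norm _))// lerBrDr -lerBrDl (le_trans yle)//
    lerBrDl -splitr.
have hx : 0 <= `|x - x0| by [].
rewrite /= in H1 H2; rewrite distrC in H1; rewrite distrC in H2.
have : c * 2^-1 * (y0 / 2) <= c * 2^-1 * (`|x - x0| + `|y - y0|).
  apply: ler_wpM2l; first by rewrite mulr_ge0// ltW.
  by rewrite -[leLHS]add0r; exact: lerD.
move: H1 H2; rewrite -/x -/y => H1 H2 A1 A2.
have := le_trans A1 A2; apply/negP; rewrite -ltNge.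
apply: (@lt_le_trans _ _ (2 * (c * y0 / 16 + c * y0 / 16))).
  by rewrite ltr_pM2l// ltrD.
by rewrite le_eqVlt; apply/orP; left; apply/eqP; field.
Qed.

(** * Properness over a half-plane *)

Section Surjectivity.
Hypothesis cUV : forall x y e : R, 0 < y -> 0 < e -> exists2 d : R, 0 < d &
  forall h k, `|h| < d -> `|k| < d ->
  `|U (x + h) (y + k) - U x y| <= e /\ `|V (x + h) (y + k) - V x y| <= e.

(** Of the compactness required by [proper_surjective], the distance to the real axis comes from
    [V_le_near_boundary]; there remain an upper bound on [|x|] and [y], and one value above [M]. The
    premise on [M - 1] passes on a gap of 1 that the slope comparison uses. *)
Lemma onto_criterion :
  integrable (`[0, +oo[ : set (measurableTypeR R)) (fun u => 1 + u ^+ 2) ->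
  alpha < 0 \/ 0 < mass \/ beta != 0 ->
  (forall C, exists x y, 0 < y /\ C < V x y) ->
  (forall M, (forall x y, x <= 1 -> 0 < y -> y <= 1 -> V x y <= M - 1) ->
    forall B, exists L, forall x y, 0 < y -> M <= V x y -> `|U x y| <= B ->
      `|V x y| <= B -> `|x| <= L /\ y <= L) ->
  exists M, forall a b, M < b -> exists x y, [/\ 0 < y, U x y = a & V x y = b].
Proof.
move=> iw nd unb bdd.
have [M0 [K [K0 HM]]] := V_le_near_boundary iw.
pose M := M0 + K + 1.
have near1 x y : x <= 1 -> 0 < y -> y <= 1 -> V x y <= M - 1.
  move=> x1 y0 y1; have := HM 1 x y (lexx _) x1 y0 y1.
  have : y * K <= 1 * K by rewrite ler_wpM2r.
  by rewrite /M; lra.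
have [x1 [y1 [y1p HV]]] := unb M.
exists M; apply: (proper_surjective dU dV cUV _ _ y1p HV).
  by move=> x y y0; exact: rep_neq0.
move=> B; have [L HL] := bdd M near1 B.
(* A point with [x <= X] and [y < 1 / X] has [V <= M0 + K], below [M]. *)
pose X := Num.max L 1.
have X1 : 1 <= X by rewrite le_max lexx orbT.
have LX : L <= X by rewrite le_max lexx.
have X0 : 0 < X := lt_le_trans ltr01 X1.
exists X, X^-1; split; first by rewrite invr_gt0.
move=> x y y0 MV UB VB; have [xL yL] := HL x y y0 MV UB VB.
rewrite (le_trans xL LX) (le_trans yL LX) andbT; split => //.
rewrite leNgt; apply/negP => yX.
have Xy : X * y < 1 by rewrite mulrC -ltr_pdivlMr// div1r.
have y1' : y <= 1 by apply: le_trans (ltW yX) _; rewrite invf_le1.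
have xX : x <= X by apply: le_trans LX; apply: le_trans xL; exact: ler_norm.
have := HM X x y X1 xX y0 y1'.
have : X * y * K <= 1 * K by rewrite ler_wpM2r// ltW.
by move: MV; rewrite /M; lra.
Qed.

(** The term [alpha z] alone gives [q >= - alpha y], and the first half of any chord from [(1, 1)]
    stays above height [1 / 2]. *)
Lemma onto_quadratic :
  integrable (`[0, +oo[ : set (measurableTypeR R)) (fun u => 1 + u ^+ 2) ->
  alpha < 0 ->
  exists M, forall a b, M < b -> exists x y, [/\ 0 < y, U x y = a & V x y = b].
Proof.
move=> iw a0.
have na0 : 0 < - alpha by rewrite oppr_gt0.
apply: onto_criterion => //; first by left.
- move=> C; pose x := `|C - V 0 1| / (- alpha) + 1.
  have x0 : 0 <= x by rewrite /x addr_ge0// divr_ge0// ltW.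
  exists x, 1; split => //.
  have := @derive_ge_increment R (V ^~ 1) (q ^~ 1) 0 x (- alpha) x0.
  have h1 (t : R) : 0 <= t <= x -> is_derive t 1 (V ^~ 1) (q t 1) by move=> _; exact: dVx.
  have h2 (t : R) : 0 <= t <= x -> - alpha <= q t 1.
    by move=> _; rewrite -[leLHS]mulr1; exact: rep_im_ge_alpha.
  move=> /(_ h1 h2); rewrite subr0 /x mulrDr mulr1 mulrCA divff ?gt_eqF// mulr1.
  by have := ler_norm (C - V 0 1); lra.
move=> M _ B.
pose c := - alpha / 2.
have c0 : 0 < c by rewrite divr_gt0.
(* The 4 is the factor 2 of [slope_dist] divided by the half length; the final 1 passes from
   [|x - 1|] to [|x|]. *)
pose L := 4 * (2 * B + `|U 1 1| + `|V 1 1|) / c + 1.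
exists L => x y y0 _ UB VB.
have half : (0 : R) <= 2^-1 by rewrite invr_ge0.
have half1 : 2^-1 <= (1 : R) by rewrite invf_le1// ler1n.
have seg t : 0 <= t <= 2^-1 -> c <= q (1 + t * (x - 1)) (1 + t * (y - 1)).
  move=> /andP[t0 t1].
  have yt : 2^-1 <= 1 + t * (y - 1).
    by have : 0 <= t * y by [rewrite mulr_ge0// ltW]; lra.
  have yt0 : 0 < 1 + t * (y - 1) by apply: lt_le_trans yt; rewrite invr_gt0.
  apply: le_trans (rep_im_ge_alpha nu alpha _ yt0).
  by rewrite /c ler_wpM2l// ltW.
have := slope_dist dU dV q_ge0 (lexx 0) half half1 ltr01 y0 (ltW c0) seg.
rewrite subr0.
have tU := ler_normB (U x y) (U 1 1); have tV := ler_normB (V x y) (V 1 1) => H.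
have : `|x - 1| + `|y - 1| <= 4 * (2 * B + `|U 1 1| + `|V 1 1|) / c.
  by rewrite ler_pdivlMr//; lra.
have h1 := normr_ge0 (x - 1); have h2 := normr_ge0 (y - 1).
have := ler_norm (y - 1); have := ler_normD (x - 1) 1; rewrite subrK normr1 /L.
by lra.
Qed.

Lemma bounded_of_cone (M : R) :
  (forall x y, x <= 1 -> 0 < y -> y <= 1 -> V x y <= M - 1) ->
  (forall C, exists x y, 0 < y /\ C < V x y) ->
  (forall k B, 0 <= k -> exists Y, forall x y, Y <= y -> 0 < y -> `|x| <= k * y ->
     `|U x y| <= B -> B < `|V x y|) ->
  forall B, exists L, forall x y, 0 < y -> M <= V x y -> `|U x y| <= B ->
      `|V x y| <= B -> `|x| <= L /\ y <= L.
Proof.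
move=> near1 unb cone B.
pose B' := `|B|.
have BB : B <= B' := ler_norm B.
have [x1 [y1 [y1p HV]]] := unb (B' + 1).
pose E := B' + `|U 1 1| + `|U x1 y1| + `|x1| + 1.
have E1 : 1 <= E.
  have := normr_ge0 B; have := normr_ge0 (U 1 1); have := normr_ge0 (U x1 y1).
  by have := normr_ge0 x1; rewrite /E /B'; lra.
have E0 : 0 <= E := le_trans ler01 E1.
pose k := E * (2 + y1).
have k0 : 0 <= k by rewrite mulr_ge0// addr_ge0// ltW.
have Ey1 : 0 <= E * y1 by rewrite mulr_ge0// ltW.
have x1E : `|x1| <= E.
  by rewrite /E; have := normr_ge0 B; have := normr_ge0 (U 1 1);
     have := normr_ge0 (U x1 y1); rewrite -/B'; lra.
have slant x y : 0 < y -> M <= V x y -> `|U x y| <= B -> `|V x y| <= B ->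
    `|x| <= k * (1 + y).
  move=> y0 MV UB VB.
  have Ey : 0 <= E * y by rewrite mulr_ge0// ltW.
  have ky : 0 <= E * y * (2 + y1) by apply: mulr_ge0 => //; lra.
  have UB' : `|U x y| <= B' := le_trans UB BB.
  have VB' : V x y <= B' by apply: le_trans (ler_norm _) (le_trans VB BB).
  have kE : k * (1 + y) = E * 2 + E * y1 + E * y * (2 + y1) by rewrite /k; ring.
  have Eyy1 : 0 <= E * y * y1 by rewrite mulr_ge0// ltW.
  (* On the left, the chord from [(1, 1)] decides: [V] exceeds [V 1 1] by at least 1, so
     [1 - x <= (U 1 1 - U x y) (y - 1)], which is linear in [y]. *)
  have [xlt1|x1le] := ltP x 1.
    have y1' : 1 < y.
      rewrite ltNge; apply/negP => y1'.
      by have := near1 x y (ltW xlt1) y0 y1'; lra.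
    have V1 : V 1 1 <= M - 1 by apply: near1.
    have sl := slope dU dV q_ge0 1 x ltr01 y0.
    have h1 : (V x y - V 1 1) * (x - 1) <= x - 1.
      rewrite -subr_ge0 (_ : _ - _ = (V x y - V 1 1 - 1) * (1 - x)); last by ring.
      by rewrite mulr_ge0//; lra.
    have h2 : (U 1 1 - U x y) * (y - 1) <= E * (y - 1).
      rewrite ler_wpM2r//; first by lra.
      have := ler_norm (U 1 1); have := ler_norm (- U x y); rewrite normrN.
      have := normr_ge0 (U x1 y1); have := normr_ge0 x1; rewrite /E; lra.
    have h3 : 1 - x <= E * y by lra.
    by rewrite kE ler_norml; lra.
  have x0 : 0 <= x by lra.
  rewrite ger0_norm//.
  have [xx1|xx1] := leP x x1.
    by apply: (le_trans xx1); apply: (le_trans (ler_norm x1)); rewrite kE; lra.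
  (* On the right the signs are reversed: [V x1 y1] exceeds [V x y] by at least 1, and the same
     inequality bounds [x - x1]. *)
  have sl := slope dU dV q_ge0 x1 x y1p y0.
  have h1 : (V x y - V x1 y1) * (x - x1) <= - (x - x1).
    rewrite -subr_ge0 (_ : _ - _ = (V x1 y1 - V x y - 1) * (x - x1)); last by ring.
    by rewrite mulr_ge0//; lra.
  have h2 : x - x1 <= `|U x1 y1 - U x y| * `|y - y1|.
    have := ler_norm ((U x1 y1 - U x y) * (y - y1)); rewrite normrM; lra.
  have h3 : `|U x1 y1 - U x y| <= E.
    have := ler_normB (U x1 y1) (U x y); have := normr_ge0 (U 1 1).
    have := normr_ge0 x1; rewrite /E; lra.
  have h4 : `|y - y1| <= y + y1.
    by apply: le_trans (ler_normB _ _) _; rewrite !gtr0_norm.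
  have h5 : `|U x1 y1 - U x y| * `|y - y1| <= E * (y + y1) by apply: ler_pM.
  by have := ler_norm x1; rewrite kE; lra.
(* For [y >= 1], [k (1 + y) <= 2 k y], a genuine cone at the origin. *)
have [Y HY] := cone (2 * k) B (mulr_ge0 (ler0n _ 2) k0).
pose Y' := Num.max Y 1.
have Y'1 : 1 <= Y' by rewrite le_max lexx orbT.
exists (k * (1 + Y') + Y') => x y y0 MV UB VB.
have xk := slant x y y0 MV UB VB.
have kY : 0 <= k * (1 + Y') by rewrite mulr_ge0//; lra.
have yY : y <= Y'.
  rewrite leNgt; apply/negP => Yy.
  have YY : Y <= y by apply: le_trans (ltW Yy); rewrite le_max lexx.
  have xk2 : `|x| <= 2 * k * y.
    apply: (le_trans xk); rewrite -subr_ge0 (_ : _ - _ = k * (y - 1)); last by ring.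
    by rewrite mulr_ge0//; lra.
  by have := HY x y YY y0 xk2 UB; lra.
split; last by lra.
apply: (le_trans xk).
have : k * (1 + y) <= k * (1 + Y') by rewrite ler_wpM2l// lerD2l.
by lra.
Qed.

Hypothesis alpha0 : alpha = 0.

(** On the imaginary axis [re_kernel] is [u (y^2 - 1) / (u^2 + y^2)], which tends to [u]; its
    negative values for [u < - T] only help. So [p 0 y] is eventually at least [e], half the
    absolute value of the truncated mean. *)
Lemma V_unbounded (T : R) : 0 < T ->
  integrable (`[- T, +oo[ : set (measurableTypeR R)) (fun u => u) ->
  beta + \int[nu]_(u in (`[- T, +oo[ : set (measurableTypeR R))) u < 0 ->
  forall C, exists x y, 0 < y /\ C < V x y.
Proof.
move=> T0; set D : set (measurableTypeR R) := (X in integrable X _) => iu neg C.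
have mD : measurable D by exact: measurable_itv.
have inD u : (u \in D) = (- T <= u).
  by apply/idP/idP => [/set_mem|h]; [|apply/mem_set]; rewrite /D /= in_itv /= andbT.
pose e := - (beta + \int[nu]_(u in D) u) / 2.
have e0 : 0 < e by rewrite /e; lra.
have m0 : 0 <= mass := mass_ge0 nu.
pose Y := 1 + (1 + T ^+ 2) * T * mass / e.
have Y1 : 1 <= Y.
  by rewrite /Y lerDl divr_ge0 ?(ltW e0)// !mulr_ge0 ?(ltW T0)// one_sqr_ge0.
have pge y : Y <= y -> e <= p 0 y.
  move=> Yy; have y1 : 1 <= y := le_trans Y1 Yy.
  have y0 : 0 < y := lt_le_trans ltr01 y1.
  have dT : 0 < y ^+ 2 + T ^+ 2 by rewrite addr_gt0// exprn_gt0.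
  pose l := (1 + T ^+ 2) / (y ^+ 2 + T ^+ 2).
  have l0 : 0 <= l by rewrite divr_ge0 ?one_sqr_ge0// ltW.
  have lT : 0 <= l * T by rewrite mulr_ge0// ltW.
  have yy : 1 <= y ^+ 2 by rewrite -[leLHS](expr1n _ 2) ler_pXn2r ?nnegrE// ltW.
  (* Off [D] the patched identity takes the default value 0, which exceeds the kernel there. On [[-
     T, 0[] the kernel differs from [u] by at most [l * T]. *)
  have bnd u : re_kernel 0 y u <= (id \_ D) u + l * T.
    rewrite /patch inD /re_kernel sub0r sqrrN.
    have du : 0 < u ^+ 2 + y ^+ 2 := sqrD_gt0 u y0.
    have -> : u + (1 + u ^+ 2) * (- u / (u ^+ 2 + y ^+ 2)) =
        u * ((y ^+ 2 - 1) / (u ^+ 2 + y ^+ 2)) by field; rewrite gt_eqF.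
    set r := (y ^+ 2 - 1) / _.
    have r0 : 0 <= r by rewrite divr_ge0 ?subr_ge0// ltW.
    have r1 : r <= 1 by rewrite ler_pdivrMr// mul1r; have := sqr_ge0 u; lra.
    have [u0|u0] := leP 0 u.
      have -> : - T <= u by lra.
      have : u * r <= u * 1 by rewrite ler_wpM2l.
      by rewrite mulr1; lra.
    have ur : u * r <= 0 by rewrite mulr_le0_ge0// ltW.
    case: (leP (- T) u) => uT; last by rewrite /point /= ; lra.
    have rl : 1 - l <= r.
      have -> : 1 - l = (y ^+ 2 - 1) / (y ^+ 2 + T ^+ 2).
        by rewrite /l; field; rewrite gt_eqF.
      rewrite ler_wpM2l ?subr_ge0// lef_pV2 ?posrE// addrC lerD2l.
      have : 0 <= (T + u) * (T - u) by rewrite mulr_ge0//; lra.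
      by lra.
    have h1 : 0 <= - u * (r - (1 - l)) by rewrite mulr_ge0 ?subr_ge0// oppr_ge0 ltW.
    have h2 : 0 <= (T + u) * l by rewrite mulr_ge0//; lra.
    by rewrite /=; lra.
  have iDT : integrable setT (id \_ D).
    have := iu; rewrite (integrable_mkcond _ mD).
    by apply: eq_integrable => // u _; rewrite /= /patch; case: ifP.
  have ire : \int[nu]_u re_kernel 0 y u <= \int[nu]_(u in D) u + l * T * mass.
    rewrite [\int[nu]_(u in D) _]Rintegral_mkcond -(Rintegral_cst_setT nu).
    rewrite -RintegralD//; last exact: integrable_cst.
    apply: le_Rintegral => //; first exact: integrable_re_kernel.
    by apply: integrable_sum => //; exact: integrable_cst.
  have le_e : l * T * mass <= e.
    have -> : l * T * mass = ((1 + T ^+ 2) * T * mass) / (y ^+ 2 + T ^+ 2).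
      by rewrite /l; ring.
    rewrite ler_pdivrMr// [e * _]mulrC -ler_pdivrMr//.
    have : y <= y ^+ 2 by rewrite expr2 ler_peMr// ltW.
    have := sqr_ge0 T; rewrite /Y in Yy; lra.
  by rewrite /rep_re alpha0 oppr0 mul0r /e in le_e *; lra.
pose z := Y + `|C - V 0 Y| / e + 1.
have Yz : Y <= z.
  by rewrite /z -addrA lerDl addr_ge0// divr_ge0// ltW.
exists 0, z; split; first by lra.
have h1 (t : R) : Y <= t <= z -> is_derive t 1 (V 0) (p 0 t).
  by move=> /andP[Yt _]; apply: dVy; lra.
have h2 (t : R) : Y <= t <= z -> e <= p 0 t by move=> /andP[Yt _]; exact: pge.
have := derive_ge_increment Yz h1 h2.
have -> : e * (z - Y) = `|C - V 0 Y| + e by rewrite /z; field; rewrite gt_eqF.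
by have := ler_norm (C - V 0 Y); lra.
Qed.

(** In the cone [q] is at least a multiple of [I / y] on a portion of the segment from [(0, 1)],
    whose length is of order [y]. The displacement of [Psi] is then at least a multiple of [I],
    whatever [y], and [I] can be taken as large as desired. *)
Lemma cone_heavy_left (k B : R) : 0 <= k ->
  (forall c : R, exists2 T : R, 0 < T &
    c < \int[nu]_(u in (`]-oo, 0[ : set (measurableTypeR R)) `&` `[- T, T]) (u ^+ 2)) ->
  exists Y, forall x y, Y <= y -> 0 < y -> `|x| <= k * y -> `|U x y| <= B -> B < `|V x y|.
Proof.
move=> k0 heavy.
(* With [|u| <= T <= y] and [|x| <= k y], the denominators of the kernel are at most [K y^2]. *)
pose K := (k + 1) ^+ 2 + 1.
have K0 : 0 < K by rewrite /K; have := sqr_ge0 (k + 1); lra.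
(* [slope_dist] will give [I / (16 K)] on the left and a factor 2 on the right, whence 32. *)
have [T T0 HT] := heavy (32 * K * (2 * `|B| + `|U 0 1| + `|V 0 1|)).
set D : set (measurableTypeR R) := _ `&` _ in HT.
have mD : measurable D by apply: measurableI; exact: measurable_itv.
have DT u : D u -> - T <= u <= 0.
  by move=> [] /=; rewrite !in_itv /= => /ltW -> /andP[->].
set I := \int[nu]_(u in D) _ in HT.
have I0 : 0 <= I by apply: Rintegral_ge0 => u _; exact: sqr_ge0.
exists (Num.max T 2) => x y Yy y0 xk UB; rewrite ltNge; apply/negP => VB.
have Ty : T <= y by apply: le_trans Yy; rewrite le_max lexx.
have y2 : 2 <= y by apply: le_trans Yy; rewrite le_max lexx orbT.
pose c := I / (2 * K * y).
have Ky : 0 < 2 * K * y by rewrite !mulr_gt0.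
have c0 : 0 <= c by rewrite divr_ge0// ltW.
have seg t : 2^-1 <= t <= 3 / 4 -> c <= q (0 + t * (x - 0)) (1 + t * (y - 1)).
  move=> /andP[t1 t2].
  have t0 : 0 < t by apply: lt_le_trans t1; rewrite invr_gt0.
  rewrite subr0 add0r; set yt := 1 + _; set xt := t * x.
  have ty1 : 2^-1 * y <= t * y by rewrite ler_wpM2r// ltW.
  have ty2 : t * (y - 1) <= 3 / 4 * (y - 1) by rewrite ler_wpM2r//; lra.
  have yt1 : y / 2 <= yt by rewrite /yt; lra.
  have yt2 : yt <= y by rewrite /yt; lra.
  have yt0 : 0 < yt by lra.
  have xtk : `|xt| <= k * y.
    rewrite /xt normrM (gtr0_norm t0); apply: le_trans xk.
    by rewrite ler_piMl//; lra.
  apply: le_trans (rep_im_ge_set nu alpha_le0 xt mD yt0).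
  have isq : integrable D (fun u => u ^+ 2).
    apply: (bounded_continuous_integrable nu (k := T ^+ 2) mD).
      exact: exprn_continuous.
    move=> u /DT /andP[u1 u2]; rewrite ger0_norm ?sqr_ge0// -sqrrN.
    by rewrite ler_pXn2r ?nnegrE//; lra.
  have -> : c = (2 * K * y)^-1 * I by rewrite /c mulrC.
  rewrite /I -RintegralZl//; apply: le_Rintegral => //.
  - exact: integrable_scale.
  - exact: integrable_im_kernel.
  - move=> u Du; have /andP[u1 u2] := DT u Du.
    have den0 : 0 < (xt - u) ^+ 2 + yt ^+ 2 := sqrD_gt0 _ yt0.
    have denK : (xt - u) ^+ 2 + yt ^+ 2 <= K * y ^+ 2.
      have h1 : `|xt - u| <= (k + 1) * y.
        apply: le_trans (ler_normB _ _) _; rewrite (ler0_norm u2); lra.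
      have h2 : (xt - u) ^+ 2 <= ((k + 1) * y) ^+ 2.
        rewrite -(real_normK (num_real (xt - u))) ler_pXn2r ?nnegrE//.
        by apply: mulr_ge0; lra.
      have h3 : yt ^+ 2 <= y ^+ 2 by rewrite ler_pXn2r ?nnegrE ?(ltW yt0) ?(ltW y0).
      by rewrite /K; rewrite exprMn in h2; lra.
    rewrite /im_kernel mulrC; apply: ler_pM.
    + exact: sqr_ge0.
    + by rewrite invr_ge0 ltW.
    + by rewrite lerDr.
    + rewrite ler_pdivlMr// mulrC ler_pdivrMr//.
      apply: (le_trans denK); rewrite (_ : _ * _ = y / 2 * (2 * K * y)); last by field.
      by rewrite ler_wpM2r// ltW.
have half : (0 : R) <= 2^-1 by rewrite invr_ge0.
have l1 : 2^-1 <= 3 / 4 :> R by lra.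
have l2 : 3 / 4 <= 1 :> R by lra.
have := slope_dist dU dV q_ge0 half l1 l2 ltr01 y0 c0 seg.
have hy : y / 2 <= `|y - 1| by rewrite ger0_norm; lra.
have cy : c * 4^-1 * (y / 2) = I / (16 * K) by rewrite /c; field; rewrite !gt_eqF.
have : c * (3 / 4 - 2^-1) * (y / 2) <= c * (3 / 4 - 2^-1) * (`|x - 0| + `|y - 1|).
  apply: ler_wpM2l; first by rewrite mulr_ge0//; lra.
  by rewrite -[leLHS]add0r; exact: lerD.
have -> : 3 / 4 - 2^-1 = 4^-1 :> R by field.
rewrite cy => A1 A2.
have A3 : I / (16 * K) <= 2 * (2 * `|B| + `|U 0 1| + `|V 0 1|).
  apply: (le_trans A1); apply: (le_trans A2); rewrite ler_wpM2l//.
  have := ler_normB (U x y) (U 0 1); have := ler_normB (V x y) (V 0 1).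
  by have := ler_norm B; lra.
move: A3; rewrite ler_pdivrMr ?mulr_gt0// => A3; move: HT; lra.
Qed.

(** With finite second moment, [q] is [O(1/y)] and [p] is at least [2 e - O(1/y)], so [V] grows at
    rate [e] along the ray [x = - k y], the left edge of the cone. Monotonicity in [x] extends this
    to the whole cone. *)
Lemma cone_light_left (k B : R) : 0 <= k ->
  integrable setT (fun u => 1 + u ^+ 2) -> integrable setT (fun u => u) ->
  beta + \int[nu]_u u < 0 ->
  exists Y, forall x y, Y <= y -> 0 < y -> `|x| <= k * y -> `|U x y| <= B -> B < `|V x y|.
Proof.
move=> k0 iw iu neg.
pose e := - (beta + \int[nu]_u u) / 2.
have e0 : 0 < e by rewrite /e; lra.
pose m2 := \int[nu]_u (1 + u ^+ 2).
have m20 : 0 <= m2 by apply: Rintegral_ge0 => u _; exact: one_sqr_ge0.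
(* Beyond [S] the errors in [p] and in [k q] together cost at most [e] of the [2 e] available. *)
pose S := 1 + (1 + k) * m2 / e.
have S1 : 1 <= S.
  by rewrite /S lerDl divr_ge0 ?(ltW e0)// mulr_ge0// addr_ge0.
have im_le x y : 0 < y -> q x y <= y^-1 * m2.
  move=> y0; rewrite /rep_im alpha0 oppr0 mul0r add0r -RintegralZl//.
  apply: le_Rintegral => //; [exact: integrable_im_kernel|exact: integrable_scale|].
  move=> u _; rewrite /im_kernel mulrC ler_wpM2r ?one_sqr_ge0//.
  by rewrite ler_pdivrMr ?sqrD_gt0// ler_pdivlMl// -expr2 lerDr sqr_ge0.
have re_ge x y : 0 < y -> 2 * e - y^-1 * m2 <= p x y.
  move=> y0; rewrite /rep_re alpha0 oppr0 mul0r.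
  suff : \int[nu]_u re_kernel x y u <= \int[nu]_u u + y^-1 * m2 by rewrite /e; lra.
  rewrite -RintegralZl// -RintegralD//; last exact: integrable_scale.
  apply: le_Rintegral => //; first exact: integrable_re_kernel.
    by apply: integrable_sum => //; exact: integrable_scale.
  move=> u _; rewrite lerD2l mulrC ler_wpM2r ?one_sqr_ge0//.
  rewrite ler_pdivrMr ?sqrD_gt0// ler_pdivlMl//.
  by have := sqr_ge0 (x - u - y); have := sqr_ge0 (x - u); have := sqr_ge0 y; lra.
pose f s := V (s * - k) s.
have df (s : R) : S <= s -> is_derive s 1 f (q (s * - k) s * - k + p (s * - k) s).
  move=> Ss; have s0 : 0 < 0 + s * 1 by rewrite mulr1 add0r; lra.
  have := dV 0 (- k) s0; rewrite !mulr1 !add0r; congr (is_derive _ _ _ _).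
  by apply/funext => t; rewrite mulr1 !add0r.
have df_ge s : S <= s -> e <= q (s * - k) s * - k + p (s * - k) s.
  move=> Ss; have s0 : 0 < s by lra.
  have h1 : q (s * - k) s * k <= s^-1 * m2 * k by rewrite ler_wpM2r// im_le.
  have h2 := re_ge (s * - k) s s0.
  have h3 : s^-1 * m2 * (1 + k) <= e.
    rewrite -mulrA ler_pdivrMl// -ler_pdivrMr// mulrC [m2 * _]mulrC.
    by move: Ss; rewrite /S mulrC; lra.
  lra.
exists (S + `|B - f S| / e + 1) => x y Yy y0 xk UB.
have Sy : S <= y.
  by apply: le_trans Yy; rewrite -addrA lerDl addr_ge0// divr_ge0// ltW.
have := @derive_ge_increment R f _ S y e Sy
  (fun t h => df t (andP h).1) (fun t h => df_ge t (andP h).1).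
have : e * (`|B - f S| / e + 1) <= e * (y - S) by rewrite ler_wpM2l ?(ltW e0)//; lra.
rewrite mulrDr mulr1 mulrCA divff ?gt_eqF// mulr1 => h1 h2.
have fy : f y <= V x y.
  apply: V_mono => //; move: xk; rewrite ler_norml; lra.
have := ler_norm (B - f S); have := ler_norm (V x y); lra.
Qed.

End Surjectivity.
End Primitive.

(** * Integrability conditions on the tails *)

Section TailConditions.
Variable R : realType.
Variable nu : {finite_measure set (measurableTypeR R) -> \bar R}.
Local Notation integrable D f := (nu.-integrable D (EFin \o f)).
Local Notation mass := (fine (nu setT)).
Let Dp : set (measurableTypeR R) := `[0, +oo[.
Let Dn : set (measurableTypeR R) := `]-oo, 0[.

Let mDp : measurable Dp. Proof. exact: measurable_itv. Qed.
Let mDn : measurable Dn. Proof. exact: measurable_itv. Qed.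

Lemma negative_ray_disjoint (D : set (measurableTypeR R)) :
  D `<=` Dn -> [disjoint D & Dp].
Proof.
move=> DD; apply/disj_set2P; apply/seteqP; split => // u [/DD].
by rewrite /Dn /Dp /= !in_itv /= andbT => h1 h2; move: (lt_le_trans h1 h2); rewrite ltxx.
Qed.

Lemma rays_cover : Dn `|` Dp = setT.
Proof.
apply/seteqP; split => // u _; case: (ltP u 0) => u0; [left|right].
  by rewrite /Dn /= in_itv.
by rewrite /Dp /= in_itv /= u0.
Qed.

Lemma integrable_of_rays (f : R -> R) : continuous f ->
  integrable Dn f -> integrable Dp f -> integrable setT f.
Proof.
move=> cf /integrableP[_ h1] /integrableP[_ h2]; apply/integrableP; split.
  exact: continuous_measurable_EFin.
rewrite -rays_cover ge0_integral_setU//; first exact: lte_add_pinfty.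
- apply: (continuous_measurable_EFin (f := fun u => `|f u|)).
  by move=> u; apply: cvg_norm; exact: cf.
- exact: negative_ray_disjoint.
Qed.

Lemma ge0_integrable_of_lty (D : set (measurableTypeR R)) (f : R -> R) : measurable D ->
  continuous f -> (forall u, D u -> 0 <= f u) ->
  (\int[nu]_(u in D) (f u)%:E < +oo)%E -> integrable D f.
Proof.
move=> mD cf f0 fy; apply/integrableP; split; first exact: continuous_measurable_EFin.
rewrite (_ : (\int[nu]_(x in D) _)%E = (\int[nu]_(u in D) (f u)%:E)%E)//.
by apply: eq_integral => u /set_mem Du; rewrite /= ger0_norm// f0.
Qed.

Lemma truncate_of_infinite (D : set (measurableTypeR R)) (f : R -> R) : measurable D ->
  continuous f -> (forall u, D u -> 0 <= f u) ->
  ~~ (\int[nu]_(u in D) (f u)%:E < +oo)%E ->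
  forall c : R, exists2 N : R, 0 < N & c < \int[nu]_(u in D `&` `[- N, N]) f u.
Proof.
move=> mD cf f0; rewrite -leNgt leye_eq => /eqP fy c.
by apply: truncate_integral => //; rewrite fy ltry.
Qed.

Lemma integrable_weight (D : set (measurableTypeR R)) : measurable D ->
  (\int[nu]_(u in D) (u ^+ 2)%:E < +oo)%E -> integrable D (fun u => 1 + u ^+ 2).
Proof.
move=> mD H; apply: integrable_sum => //; first exact: integrable_cst.
apply: (ge0_integrable_of_lty mD (f := fun u => u ^+ 2)) => //.
  exact: exprn_continuous.
by move=> u _; exact: sqr_ge0.
Qed.

Lemma integrable_id_of_weight (D : set (measurableTypeR R)) : measurable D ->
  integrable D (fun u => 1 + u ^+ 2) -> integrable D (fun u => u).
Proof.
move=> mD iw; apply: (continuous_integrable mD _ iw); first by move=> u; exact: cvg_id.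
by move=> u _; rewrite ler_norml; have := sqr_ge0 (u - 1); have := sqr_ge0 (u + 1);
   have := sqr_ge0 u; lra.
Qed.

(** Isolates the only possible infinity once the right ray is integrable: the subtracted integral is
    nonnegative and may be [+oo]. *)
Lemma integral_rays : (\int[nu]_u u%:E =
  \int[nu]_(u in Dp) u%:E - \int[nu]_(u in Dn) (- u)%:E)%E.
Proof.
have mid : measurable_fun (Dn `|` Dp) (EFin \o @id R).
  by apply: continuous_measurable_EFin => u; exact: cvg_id.
have disj : [disjoint Dn & Dp] by exact: negative_ray_disjoint.
rewrite -{1}rays_cover (integral_setU nu mDn mDp mid disj) addeC; congr (_ + _)%E.
rewrite -integral_ge0N; last first.
  by move=> u; rewrite /Dn /= in_itv /= => u0; rewrite lee_fin oppr_ge0 ltW.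
by apply: eq_integral => u _; rewrite EFinN oppeK.
Qed.

Lemma EFin_Rintegral (D : set (measurableTypeR R)) (f : R -> R) : measurable D ->
  integrable D f -> (\int[nu]_(u in D) (f u)%:E = (\int[nu]_(u in D) f u)%:E)%E.
Proof. by move=> mD fi; rewrite /Rintegral fineK//; exact: integrable_fin_num fi. Qed.

(** The mean may be [-oo]; a cutoff at [- T] makes it finite and keeps it negative. The final
    disjunction is the nondegeneracy required by [rep_neq0]. *)
Lemma mean_negative_truncate (beta : R) : integrable Dp (fun u => u) ->
  (beta%:E + \int[nu]_u u%:E < 0)%E ->
  exists2 T : R, 0 < T & integrable (`[- T, +oo[ : set (measurableTypeR R)) (fun u => u) /\
    [/\ beta + \int[nu]_(u in (`[- T, +oo[ : set (measurableTypeR R))) u < 0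
      & 0 < mass \/ beta != 0].
Proof.
move=> ip; rewrite integral_rays (EFin_Rintegral mDp ip).
set A := \int[nu]_(u in Dp) u; set B := (\int[nu]_(u in Dn) _)%E => neg.
have A0 : 0 <= A.
  by apply: Rintegral_ge0 => u; rewrite /Dp /= in_itv /= andbT.
have cN : continuous (fun u : R => - u) by move=> u; apply: cvgN; exact: cvg_id.
have n0 u : Dn u -> 0 <= - u.
  by rewrite /Dn /= in_itv /= => u0; rewrite oppr_ge0 ltW.
have BA : ((beta + A)%:E < B)%E.
  move: neg; rewrite addeA -EFinD; case: (B) => [b||] //=.
    by rewrite -EFinB !lte_fin subr_lt0.
  by rewrite ltry.
have [T T0 HT] := truncate_integral mDn cN n0 BA.
exists T => //.
set D := _ `&` _ in HT.
have mD : measurable D by apply: measurableI => //; exact: measurable_itv.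
have DT u : D u -> - T <= u < 0.
  by rewrite /D /Dn => -[] /=; rewrite !in_itv /= => -> /andP[->].
have iD : integrable D (fun u => u).
  apply: (bounded_continuous_integrable nu (k := T) mD) => [u|u /DT]; first exact: cvg_id.
  by rewrite ler_norml; lra.
pose DT' : set (measurableTypeR R) := `[- T, +oo[%classic.
have cover : DT' = D `|` Dp.
  apply/seteqP; split => u; rewrite /DT' /D /Dn /Dp /= !in_itv /= !andbT.
    move=> Tu; have [u0|u0] := ltP u 0; [left; split => //|by right].
    by rewrite Tu /=; lra.
  by move=> [[_ /andP[]]|] //; lra.
have disj : [disjoint D & Dp] by apply: negative_ray_disjoint => u [].
have iU : integrable DT' (fun u => u).
  rewrite cover; apply/integrableP; split.
    by apply: continuous_measurable_EFin => u; exact: cvg_id.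
  move: iD ip => /integrableP[_ h1] /integrableP[_ h2].
  rewrite ge0_integral_setU//; first exact: lte_add_pinfty.
  apply: (continuous_measurable_EFin (f := fun u => `|u|)) => u.
  by apply: cvg_norm; exact: cvg_id.
have ND : \int[nu]_(u in D) (- u) = - \int[nu]_(u in D) u.
  rewrite -mulN1r -RintegralZl//.
  by apply: eq_Rintegral => u _; rewrite mulN1r.
split => //; split.
  rewrite -/DT' cover; rewrite cover in iU; rewrite Rintegral_setU// -/A.
  by move: HT; rewrite ND; lra.
(* If [nu] vanishes, so does the truncated integral, and [HT] with [0 <= A] leaves [beta < 0]. *)
have [m0|m0] := ltP 0 mass; [by left|right].
have me : mass = 0 by apply/eqP; rewrite eq_le m0 mass_ge0.
rewrite lt_eqF//.
have : \int[nu]_(u in D) (- u) <= T * mass.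
  rewrite -(Rintegral_cst_setT nu); apply: (@le_trans _ _ (\int[nu]_(u in D) T)).
    apply: le_Rintegral => //; last by move=> u /DT; lra.
      have := integrable_scale (-1) mD iD.
      by apply: eq_integrable => // u _; rewrite /= mulN1r.
    exact: integrable_cst.
  by apply: le_Rintegral_set => //; [exact: integrable_cst|move=> _; exact: ltW].
by rewrite me mulr0; lra.
Qed.

(** An infinite first moment on the left would make the mean [-oo], hence negative. *)
Lemma mean_nonneg_integrable (beta : R) : integrable Dp (fun u => u) ->
  ~~ (beta%:E + \int[nu]_u u%:E < 0)%E ->
  integrable setT (fun u => u) /\ 0 <= beta + \int[nu]_u u.
Proof.
move=> ip H.
have cid : continuous (fun u : R => u) by move=> u; exact: cvg_id.
have cN : continuous (fun u : R => - u) by move=> u; apply: cvgN; exact: cvg_id.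
have n0 u : Dn u -> 0 <= - u.
  by rewrite /Dn /= in_itv /= => u0; rewrite oppr_ge0 ltW.
have iN : integrable Dn (fun u => - u).
  apply: ge0_integrable_of_lty => //; rewrite ltNge leye_eq; apply/negP => /eqP Hn.
  by move: H; rewrite integral_rays Hn (EFin_Rintegral mDp ip) /= ltNyr.
have iT : integrable setT (fun u => u).
  apply: integrable_of_rays => //.
  have := integrable_scale (-1) mDn iN.
  by apply: eq_integrable => // u _; rewrite /= mulN1r opprK.
split => //; move: H; rewrite (EFin_Rintegral measurableT iT) -EFinD lte_fin -leNgt.
by [].
Qed.

End TailConditions.

(** * From complex statements to real coordinates *)

Section ComplexPlane.
Variable R : realType.

Lemma kernel_quotient (x y u : R) : 0 < y ->
  (1 + u%:C * Complex x y) / (Complex x y - u%:C) =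
  Complex (re_kernel x y u) (- im_kernel x y u).
Proof.
move=> y0.
have d0 : (x - u) ^+ 2 + y ^+ 2 != 0 by rewrite gt_eqF// sqrD_gt0.
have z0 : Complex x y - u%:C != 0.
  by apply/eqP => /(congr1 (@complex.Im R)) /=; rewrite oppr0 addr0 => /eqP; rewrite gt_eqF.
apply: (mulIf z0); rewrite divfK//.
apply/eqP; rewrite eq_complex /re_kernel /im_kernel /=.
by apply/andP; split; apply/eqP; field.
Qed.

Lemma canonical_representation_ReIm (psi : R[i] -> R[i]) (alpha beta : R)
    (nu : {finite_measure set (measurableTypeR R) -> \bar R}) (x y : R) :
  canonical_representation psi alpha beta nu -> 0 < y ->
  complex.Re (- psi (Complex x y)) = rep_re nu alpha beta x y /\
  complex.Im (- psi (Complex x y)) = rep_im nu alpha x y.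
Proof.
move=> [_ rep] y0; rewrite Re_opp Im_opp (rep (Complex x y) y0).
rewrite !Re_is_additive !Im_is_additive /complex_integral /=.
have -> : \int[nu]_u complex.Re ((1 + u%:C * Complex x y) / (Complex x y - u%:C)) =
    \int[nu]_u re_kernel x y u.
  by apply: eq_Rintegral => u _; rewrite kernel_quotient.
have -> : \int[nu]_u complex.Im ((1 + u%:C * Complex x y) / (Complex x y - u%:C)) =
    - \int[nu]_u im_kernel x y u.
  rewrite -mulN1r -RintegralZl//; last exact: integrable_im_kernel.
  by apply: eq_Rintegral => u _; rewrite kernel_quotient//= mulN1r.
by rewrite /rep_re /rep_im; split; ring.
Qed.

(** The real part of [c] merely slides [Cplus] along itself, so a translate is a half-plane
    determined by the imaginary part of [c]. *)
Lemma contains_translateP (Psi : R[i] -> R[i]) :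
  (exists c : R[i], [set z + c | z in @Cplus R] `<=` Psi @` @Cplus R) <->
  exists M : R, forall a b : R, M < b -> exists x y : R,
    [/\ 0 < y, complex.Re (Psi (Complex x y)) = a & complex.Im (Psi (Complex x y)) = b].
Proof.
split=> [[c Hc]|[M HM]].
  exists (complex.Im c) => a b cb.
  have [] : (Psi @` @Cplus R) (Complex a b).
    apply: Hc; exists (Complex a b - c); last by rewrite subrK.
    by rewrite /Cplus /= Im_is_additive Im_opp /= subr_gt0.
  by move=> [x y] y0 E; exists x, y; rewrite E.
exists (Complex 0 M) => _ [z z0 <-].
have zM : M < complex.Im (z + Complex 0 M) by rewrite Im_is_additive /= ltrDr.
have [x [y [y0 hU hV]]] := HM (complex.Re (z + Complex 0 M)) _ zM.
exists (Complex x y) => //.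
by apply/eqP; rewrite eq_complex hU hV !eqxx.
Qed.

End ComplexPlane.

Theorem proposition3p6 (R : realType) (psi Psi : R[i] -> R[i])
    (alpha beta : R) (nu : {finite_measure set (measurableTypeR R) -> \bar R})
    (hpsi : nevanlinna psi)
    (hrep : canonical_representation psi alpha beta nu)
    (hPsi : primitive_on (@Cplus R) (fun z : R[i] => - psi z) Psi) :
  let cond1 : Prop :=
    (\int[nu]_(u in `[0%R, +oo[) (u ^+ 2)%:E < +oo)%E /\ alpha < 0 in
  let cond2 : Prop :=
    [/\ (\int[nu]_(u in `[0%R, +oo[) (u ^+ 2)%:E < +oo)%E,
        alpha = 0
      & (beta%:E + \int[nu]_u u%:E < 0)%E] in
  ((exists c : R[i], [set z + c | z in @Cplus R] `<=` Psi @` @Cplus R) <->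
     cond1 \/ cond2)
  /\ ~ (cond1 /\ cond2).
Proof.
move=> cond1 cond2; split; last by move=> [[_ a0] [_ ae _]]; move: a0; rewrite ae ltxx.
have alpha_le0 := hrep.1.
pose U x y := complex.Re (Psi (Complex x y)).
pose V x y := complex.Im (Psi (Complex x y)).
pose p := rep_re nu alpha beta; pose q := rep_im nu alpha.
have dUV (x y a b t : R) : 0 < y + t * b ->
    is_derive t 1 (fun s => U (x + s * a) (y + s * b))
      (p (x + t * a) (y + t * b) * a - q (x + t * a) (y + t * b) * b) /\
    is_derive t 1 (fun s => V (x + s * a) (y + s * b))
      (q (x + t * a) (y + t * b) * a + p (x + t * a) (y + t * b) * b).
  move=> yt; rewrite /p /q; have [<- <-] := canonical_representation_ReIm (x + t * a) hrep yt.
  by apply: is_derive_ReIm_line; exact: (hPsi (Complex (x + t * a) (y + t * b)) yt).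
have dU x y a b t yt := (dUV x y a b t yt).1.
have dV x y a b t yt := (dUV x y a b t yt).2.
have cUV (x y e : R) : 0 < y -> 0 < e -> exists2 d : R, 0 < d &
    forall h k, `|h| < d -> `|k| < d ->
    `|U (x + h) (y + k) - U x y| <= e /\ `|V (x + h) (y + k) - V x y| <= e.
  by move=> y0 e0; exact: continuous_ReIm_plane e0 (hPsi (Complex x y) y0).
rewrite contains_translateP -/U -/V.
have mDp : measurable (`[0, +oo[ : set (measurableTypeR R)) by exact: measurable_itv.
pose Dn : set (measurableTypeR R) := `]-oo, (0 : R)[%classic.
have mDn : measurable Dn by exact: measurable_itv.
have csq : continuous (fun u : R => u ^+ 2) by exact: exprn_continuous.
have [I2|/negP I2] := boolP (\int[nu]_(u in `[0%R, +oo[) (u ^+ 2)%:E < +oo)%E; last first.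
  split; last by move=> [[]|[]].
  move=> [M onto]; exfalso.
  apply: (heavy_right_tail_not_onto alpha_le0 dU dV _ onto).
  by apply: (truncate_of_infinite mDp csq) => [u _|]; [exact: sqr_ge0|exact/negP].
have iw := integrable_weight mDp I2.
have ip := integrable_id_of_weight mDp iw.
have [a0|a0] := ltP alpha 0.
  split; first by move=> _; left.
  by move=> _; have onto := onto_quadratic alpha_le0 dU dV cUV iw a0; exact onto.
have ae : alpha = 0 by apply/eqP; rewrite eq_le a0 alpha_le0.
split.
  move=> [M onto]; right; split => //.
  have [//|/(mean_nonneg_integrable ip)[iT b0]] := boolP (beta%:E + \int[nu]_u u%:E < 0)%E.
  have [C HC] := V_bounded_above alpha_le0 dU dV iw ae iT b0.
  (* The height [max M C + 1] lies above [M], hence is attained, yet exceeds the bound [C] on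
     [V]. *)
  have Mb : M < Num.max M C + 1.
    by apply: (@le_lt_trans _ _ (Num.max M C)); rewrite ?ltrDl// le_max lexx.
  have [x [y [y0 _ hV]]] := onto 0 _ Mb.
  have := HC x y y0; rewrite /V hV leNgt => /negP[].
  by apply: (@le_lt_trans _ _ (Num.max M C)); rewrite ?ltrDl// le_max lexx orbT.
move=> [[_]|[_ _ neg]]; first by rewrite ae ltxx.
have [T T0 [iU [negT nd]]] := mean_negative_truncate ip neg.
have unb := V_unbounded dU dV ae T0 iU negT.
apply: (onto_criterion alpha_le0 dU dV cUV iw _ unb); first by right.
move=> M near1.
apply: (bounded_of_cone alpha_le0 dU dV near1 unb) => k B k0.
(* The second moment on the left decides whether [p] or [q] drives [Psi] to infinity in the cone. *)
have [J2|J2] := boolP (\int[nu]_(u in Dn) (u ^+ 2)%:E < +oo)%E.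
  have iwn := integrable_weight mDn J2.
  have iwT := integrable_of_rays (@continuous_one_sqr R) iwn iw.
  have iT := integrable_id_of_weight measurableT iwT.
  apply: (cone_light_left alpha_le0 dU dV ae B k0 iwT iT).
  by move: neg; rewrite (EFin_Rintegral measurableT iT) -EFinD lte_fin.
apply: (cone_heavy_left alpha_le0 dU dV B k0).
by apply: (truncate_of_infinite mDn csq) => // u _; exact: sqr_ge0.
Qed.
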